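(* Let $X$ be a separable infinite dimensional Banach space over $\mathbb{K}$ and let $T:X\to X$ be a bounded linear operator. Assume that there is a dense linear subspace $F$ of $X$ with $T(F)\subseteq F$ such that: (B1) $F$ carries an inner product $\langle\cdot,\cdot\rangle$ such that the topology on $F$ defined by the norm $\|x\|_0=\sqrt{\langle x,x\rangle}$ is (not necessarily strictly) stronger than the topology that $F$ inherits from the norm of $X$; (B2) the continuous extension of the restriction $S=T|_F:F\to F$ to the Hilbert space completion of the normed space $(F,\|\cdot\|_0)$ is an isometry having no non-trivial finite dimensional invariant subspaces; (B3) every $x\in F$ has a backward $T$-orbit which converges to $0$ in the norm of $X$. Then $T$ is weakly hypercyclic.
   Context: $\mathbb{K}$ denotes either $\mathbb{R}$ or $\mathbb{C}$. For $x\in X$, the orbit is $O(T,x)=\{T^nx:n\in\mathbb{Z}_+\}$ ($\mathbb{Z}_+=\{0,1,2,\dots\}$). $T$ is weakly hypercyclic if there is $x\in X$ whose orbit $O(T,x)$ is dense in $X$ with respect to the weak topology of $X$. A backward $T$-orbit of $x$ is a sequence $\{x_n\}_{n\in\mathbb{Z}_+}$ in $X$ with $x_0=x$ and $Tx_{n+1}=x_n$ for every $n\in\mathbb{Z}_+$. *)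

(* Defs.v *)
From HB Require Import structures.
From mathcomp Require Import all_boot all_order all_algebra.
From mathcomp Require Import all_classical all_reals all_analysis.
From mathcomp Require Import complex.
Set Implicit Arguments. Unset Strict Implicit. Unset Printing Implicit Defensive.
Import Order.TTheory GRing.Theory Num.Theory.
Import numFieldNormedType.Exports.
Local Open Scope classical_set_scope.
Local Open Scope ring_scope.

Definition lin_subspace (K : numDomainType) (V : lmodType K) (A : set V) : Prop :=
  A 0 /\ (forall x y, A x -> A y -> A (x + y)) /\ (forall (a : K) x, A x -> A (a *: x)).

Definition span_seq (K : numDomainType) (V : lmodType K) (s : seq V) : set V :=
  [set x | exists c : 'I_(size s) -> K, x = \sum_(i < size s) c i *: s`_i].

Definition fin_dim (K : numDomainType) (V : lmodType K) (A : set V) : Prop :=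
  exists s : seq V, A `<=` span_seq s.

Definition infinite_dimensional (K : numDomainType) (V : lmodType K) : Prop :=
  ~ fin_dim [set: V].

Definition separable (T : topologicalType) : Prop :=
  exists d : nat -> T, dense (range d).

Definition orbit (V : Type) (T : V -> V) (x : V) : set V :=
  [set iter n T x | n in [set: nat]].

(* density w.r.t. the weak topology sigma(X, X^star): every basic weak
   neighbourhood of x0, i.e. the set of y with  abs(f_i y - f_i x0) < e for all
   i < n  (f_i continuous linear functionals, e > 0), meets A *)
Definition weakly_dense (K : numFieldType) (X : normedModType K) (A : set X) : Prop :=
  forall (x0 : X) (n : nat) (f : nat -> {scalar X}) (e : K),
    (forall i, continuous (f i)) -> 0 < e ->
    exists2 y, A y & forall i, (i < n)%N -> `|f i y - f i x0| < e.

Definition weakly_hypercyclic (K : numFieldType) (X : normedModType K)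
  (T : X -> X) : Prop :=
  exists x : X, weakly_dense (orbit T x).

Definition has_backward_orbit_to_0 (K : numFieldType) (X : normedModType K)
  (T : X -> X) (x : X) : Prop :=
  exists xs : nat -> X, xs 0%N = x /\ (forall n, T (xs n.+1) = xs n) /\ xs @ \oo --> (0 : X).

(* ip is an inner product on the subspace F (conjK = complex conjugation of K,
   i.e. identity over R) *)
Definition inner_product_on (K : numFieldType) (conjK : K -> K) (X : lmodType K)
  (F : set X) (ip : X -> X -> K) : Prop :=
  (forall (a : K) x y z, F x -> F y -> F z -> ip (a *: x + y) z = a * ip x z + ip y z) /\
  (forall x y, F x -> F y -> ip y x = conjK (ip x y)) /\
  (forall x, F x -> x != 0 -> 0 < ip x x).

Definition Theorem_1_2 (K : numFieldType) (conjK sqrtK : K -> K) : Prop :=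
  forall (X : completeNormedModType K) (T : {linear X -> X}) (F : set X)
         (ip : X -> X -> K),
    separable X -> infinite_dimensional X -> continuous T ->
    lin_subspace F -> dense F -> T @` F `<=` F ->
    inner_product_on conjK F ip ->
    (forall x, F x -> forall e : K, 0 < e -> exists2 d : K, 0 < d &
       forall y, F y -> sqrtK (ip (y - x) (y - x)) < d -> `|y - x| < e) ->
    (* (B2): (H, j) is the Hilbert space completion of (F, ||.||_0) and V the
       continuous extension of S = T|_F *)
    (exists (H : completeNormedModType K) (j : X -> H) (V : {linear H -> H}),
       (forall (a : K) x y, F x -> F y -> j (a *: x + y) = a *: j x + j y) /\
       (forall x, F x -> `|j x| = sqrtK (ip x x)) /\
       dense (j @` F) /\
       continuous V /\
       (forall x, F x -> V (j x) = j (T x)) /\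
       (forall h, `|V h| = `|h|) /\
           (forall M : set H, lin_subspace M -> fin_dim M ->
              (forall h, M h -> M (V h)) -> M = [set 0] \/ M = [set: H])) ->
    (forall x, F x -> has_backward_orbit_to_0 T x) ->
    weakly_hypercyclic T.

(* Main.v *)
(* Let V be the isometry extending S to the completion H of F, with inner product
   <.,.>. First, for every w in H, some V^n w with n large is almost orthogonal to
   any given finite set of vectors. Otherwise a Banach limit of |<V^n w, h>|^2
   would be a nonzero V-invariant quadratic form in h whose trace is at most
   |w|^2; its eigenspace of maximal eigenvalue would be nonzero, finite
   dimensional and V-invariant.

   Given targets y_k in F, let x be the sum of the u_k, where u_k is the term of
   index n_k of a backward orbit of y_k. With n_k growing fast, T^(n_k) x is close
   to v_k + y_k, where v_0 = 0 and v_(k+1) = S^(n_(k+1) - n_k) (v_k + y_k). By the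
   first step the v_k can be made almost orthogonal to each other and to y_k, so
   that |v_k|^2 is at most s_k = 1 + sum_(l < k) (|y_l|^2 + 1), and for a continuous
   functional f a Bessel inequality bounds sum_k |f(v_k)|^2 / s_k. Repeating one
   target makes s_k grow linearly, so the sum of 1 / s_k over the repetitions can
   be made as large as desired, and then v_k is weakly small for one of them. *)
Require Import Defs.
From HB Require Import structures.
From mathcomp Require Import all_boot all_order all_algebra.
From mathcomp Require Import all_classical all_reals all_analysis.
From mathcomp Require Import complex ring lra.
Set Implicit Arguments. Unset Strict Implicit. Unset Printing Implicit Defensive.
Import Order.TTheory GRing.Theory Num.Theory.
Import numFieldNormedType.Exports.
Local Open Scope classical_set_scope.
Local Open Scope ring_scope.
Local Open Scope complex_scope.

(* Treats both scalar fields at once: [imu] is the imaginary unit when K is the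
   complex field and 0 when K is real, and [imuP] is what polarization needs. *)
Record scalars (R : realType) (K : numFieldType) := Scalars {
  toK : {rmorphism R -> K};
  re : {additive K -> R};
  cj : {rmorphism K -> K};
  imu : K;
  toK_le : forall x y, (toK x <= toK y) = (x <= y);
  toK_re : forall k, 0 <= k -> toK (re k) = k;
  cjK : forall k, cj (cj k) = k;
  addr_cj : forall k, k + cj k = toK (2 * re k);
  mulr_cj : forall k, k * cj k = `|k| ^+ 2;
  re_le_norm : forall k, `|re k| <= re `|k|;
  cj_ge0 : forall k, 0 <= k -> cj k = k;
  imuP : forall k, 2 * k = (k + cj k) + imu * (cj imu * k + imu * cj k) }.

(** * Arithmetic common to real and complex scalars *)

Section ScalarTheory.
Context {R : realType} {K : numFieldType} (S : scalars R K).
Implicit Types (a b k : K) (t : R).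
Local Notation toK := (toK S).
Local Notation re := (re S).
Local Notation cj := (cj S).

(* Absolute values and norms are read in R, where the order is total. *)
Definition nK k : R := re `|k|.

Lemma toK_inj : injective toK.
Proof. exact: fmorph_inj. Qed.

Lemma toK_lt x y : (toK x < toK y) = (x < y).
Proof. by rewrite !lt_neqAle toK_le (inj_eq toK_inj). Qed.

Lemma toK_ge0 x : (0 <= toK x) = (0 <= x).
Proof. by rewrite -[0 in LHS](rmorph0 toK) toK_le. Qed.

Lemma toK_gt0 x : (0 < toK x) = (0 < x).
Proof. by rewrite -[0 in LHS](rmorph0 toK) toK_lt. Qed.

Lemma toK_nK k : toK (nK k) = `|k|.
Proof. by rewrite /nK toK_re. Qed.

Lemma cj_fix k : cj k = k -> toK (re k) = k.
Proof.
move=> h; have := addr_cj S k; rewrite h rmorphM rmorph_nat -mulr2n -[_ *+ 2]mulr_natl.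
by move/mulfI => <-//; rewrite pnatr_eq0.
Qed.

Lemma toK_real t : `|toK t| = toK `|t|.
Proof.
case: (leP 0 t) => t0; first by rewrite !ger0_norm ?toK_ge0.
by rewrite ler0_norm ?ltr0_norm ?rmorphN// -(rmorph0 toK) toK_le ltW.
Qed.

Lemma cj_toK t : cj (toK t) = toK t.
Proof.
case: (leP 0 t) => t0; first by rewrite cj_ge0 ?toK_ge0.
by apply: oppr_inj; rewrite -!rmorphN cj_ge0 ?toK_ge0 ?oppr_ge0 ?ltW.
Qed.

Lemma re_toK t : re (toK t) = t.
Proof. by apply: toK_inj; rewrite cj_fix// cj_toK. Qed.

Lemma re_cj k : re (cj k) = re k.
Proof.
have := addr_cj S (cj k); rewrite cjK addrC addr_cj => /toK_inj.
by move=> /(mulfI _) ->; rewrite ?pnatr_eq0.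
Qed.

Lemma re_toKM t k : re (toK t * k) = t * re k.
Proof.
have := addr_cj S (toK t * k); rewrite rmorphM cj_toK -mulrDr addr_cj -rmorphM.
by move=> /toK_inj; lra.
Qed.

Lemma nK_ge0 k : 0 <= nK k.
Proof. by rewrite -toK_ge0 toK_nK. Qed.
Lemma nK0 : nK 0 = 0.
Proof. by rewrite /nK normr0 raddf0. Qed.
Lemma nK1 : nK 1 = 1.
Proof. by apply: toK_inj; rewrite toK_nK normr1 rmorph1. Qed.
Lemma nK_eq0 k : (nK k == 0) = (k == 0).
Proof. by rewrite -(inj_eq toK_inj) toK_nK rmorph0 normr_eq0. Qed.
Lemma nKM a b : nK (a * b) = nK a * nK b.
Proof. by apply: toK_inj; rewrite rmorphM/= !toK_nK normrM. Qed.
Lemma nKD a b : nK (a + b) <= nK a + nK b.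
Proof. by rewrite -(toK_le S) rmorphD/= !toK_nK ler_normD. Qed.
Lemma nK_toK t : nK (toK t) = `|t|.
Proof. by apply: toK_inj; rewrite toK_nK toK_real. Qed.
Lemma nK_cjM k : k * cj k = toK (nK k ^+ 2).
Proof. by rewrite rmorphXn/= toK_nK mulr_cj. Qed.
Lemma nK_cj k : nK (cj k) = nK k.
Proof.
apply/eqP; rewrite -(eqrXn2 (n := 2)) ?nK_ge0//; apply/eqP/toK_inj.
by rewrite -!nK_cjM cjK mulrC.
Qed.
Lemma re_le_nK k : `|re k| <= nK k.
Proof. exact: re_le_norm. Qed.

(** * Semidefinite symmetric real forms *)

Section SymForm.
Variables (V : lmodType K) (g : V -> V -> R).
Hypothesis gD : forall x y z, g (x + y) z = g x z + g y z.
Hypothesis gC : forall x y, g x y = g y x.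
Hypothesis gZ : forall t x y, g (toK t *: x) y = t * g x y.
Hypothesis g_ge0 : forall x, 0 <= g x x.

Lemma form_expand t x y :
  g (x + toK t *: y) (x + toK t *: y) = g x x + 2 * t * g x y + t ^+ 2 * g y y.
Proof. rewrite gD gZ ![g _ (_ + _)]gC !gD !gZ (gC y x); ring. Qed.

(** The quadratic polynomial of [form_expand] is nonnegative in [t]. If [g y y] is not 0, it is
    evaluated at its minimum; otherwise it is affine in [t], and a nonzero slope would give it the
    value -1 somewhere. *)
Lemma form_CS x y : g x y ^+ 2 <= g x x * g y y.
Proof.
have h t : 0 <= g x x + 2 * t * g x y + t ^+ 2 * g y y.
  by rewrite -form_expand.
have [y0|y0] := eqVneq (g y y) 0.
  have [->|xy] := eqVneq (g x y) 0; first by rewrite y0 mulr0 expr0n.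
  have := h (- (g x x + 1) / (2 * g x y)); rewrite y0 mulr0 addr0.
  have -> : g x x + 2 * (- (g x x + 1) / (2 * g x y)) * g x y = -1 by field.
  by rewrite ler0N1.
have yp : 0 < g y y by rewrite lt_neqAle eq_sym y0 g_ge0.
have := h (- g x y / g y y).
have -> : g x x + 2 * (- g x y / g y y) * g x y + (- g x y / g y y) ^+ 2 * g y y
   = (g x x * g y y - g x y ^+ 2) / g y y by field.
by rewrite pmulr_lge0 ?invr_gt0// subr_ge0.
Qed.

Lemma form_triangle x y :
  Num.sqrt (g (x + y) (x + y)) <= Num.sqrt (g x x) + Num.sqrt (g y y).
Proof.
rewrite -(ler_pXn2r (n := 2)) ?nnegrE ?addr_ge0 ?sqrtr_ge0// sqr_sqrtr//.
rewrite sqrrD !sqr_sqrtr//.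
have -> : g (x + y) (x + y) = g x x + 2 * g x y + g y y.
  by have := form_expand 1 x y; rewrite rmorph1 scale1r => ->; ring.
suff : g x y <= Num.sqrt (g x x) * Num.sqrt (g y y) by lra.
rewrite -sqrtrM//; apply: le_trans (ler_norm _) _.
by rewrite -sqrtr_sqr; apply: ler_wsqrtr; apply: form_CS.
Qed.
End SymForm.
End ScalarTheory.

(** [H] is a bare module: its topology enters only through [ip], so completeness is phrased with
    Cauchy sequences for the norm of [ip]. *)
Record hilbert (R : realType) (K : numFieldType) (S : scalars R K) (H : lmodType K) := Hilbert {
  ip : H -> H -> K;
  ip_lin : forall a x y z, ip (a *: x + y) z = a * ip x z + ip y z;
  ip_cj : forall x y, ip y x = cj S (ip x y);
  ip_gt0 : forall x, x != 0 -> 0 < re S (ip x x);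
  ip_complete : forall u : nat -> H,
    (forall e : R, 0 < e -> exists N, forall i j, (N <= i)%N -> (N <= j)%N ->
       Num.sqrt (re S (ip (u i - u j) (u i - u j))) < e) ->
    exists l, forall e : R, 0 < e -> exists N, forall i, (N <= i)%N ->
       Num.sqrt (re S (ip (u i - l) (u i - l))) < e }.

(** * Hilbert space geometry: norms, orthonormal lists, projections *)

Section HilbertTheory.
Context {R : realType} {K : numFieldType} {S : scalars R K} {H : lmodType K}.
Variable (HH : hilbert S H).
Local Notation toK := (toK S).
Local Notation re := (re S).
Local Notation cj := (cj S).
Local Notation nK := (nK S).
Local Notation ip := (ip HH).
Implicit Types (x y z u : H) (s : seq H).

Lemma ip0l z : ip 0 z = 0.
Proof.
by have := ip_lin HH 1 0 0 z; rewrite scaler0 addr0 mul1r -{1}[ip 0 z]addr0 => /addrI.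
Qed.
Lemma ipDl x y z : ip (x + y) z = ip x z + ip y z.
Proof. by rewrite -[x in LHS]scale1r ip_lin mul1r. Qed.
Lemma ipZl a x z : ip (a *: x) z = a * ip x z.
Proof. by rewrite -[_ *: _]addr0 ip_lin ip0l addr0. Qed.
Lemma ipNl x z : ip (- x) z = - ip x z.
Proof. by rewrite -scaleN1r ipZl mulN1r. Qed.
Lemma ipBl x y z : ip (x - y) z = ip x z - ip y z.
Proof. by rewrite ipDl ipNl. Qed.
Lemma ipDr x y z : ip z (x + y) = ip z x + ip z y.
Proof. by rewrite ip_cj ipDl rmorphD -!ip_cj. Qed.
Lemma ipZr a x z : ip z (a *: x) = cj a * ip z x.
Proof. by rewrite ip_cj ipZl rmorphM -ip_cj. Qed.
Lemma ipBr x y z : ip z (x - y) = ip z x - ip z y.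
Proof. by rewrite ip_cj ipBl rmorphB -!ip_cj. Qed.
Lemma ip_suml (I : Type) (r : seq I) (F : I -> H) z :
  ip (\sum_(i <- r) F i) z = \sum_(i <- r) ip (F i) z.
Proof.
elim: r => [|i r IH]; first by rewrite !big_nil ip0l.
by rewrite !big_cons ipDl IH.
Qed.

Definition qH x := re (ip x x).
Definition nH x := Num.sqrt (qH x).

Lemma qH_ge0 x : 0 <= qH x.
Proof.
rewrite /qH; have [->|/(ip_gt0 HH)/ltW//] := eqVneq x 0.
by rewrite ip0l raddf0.
Qed.
Lemma nH_ge0 x : 0 <= nH x. Proof. exact: sqrtr_ge0. Qed.
Lemma nH_sqr x : nH x ^+ 2 = qH x. Proof. by rewrite sqr_sqrtr// qH_ge0. Qed.
Lemma ip_qH x : ip x x = toK (qH x).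
Proof. by rewrite cj_fix// -ip_cj. Qed.
Lemma qH0 : qH 0 = 0. Proof. by rewrite /qH ip0l raddf0. Qed.
Lemma nH0 : nH 0 = 0. Proof. by rewrite /nH qH0 sqrtr0. Qed.
Lemma qH_eq0 x : (qH x == 0) = (x == 0).
Proof.
apply/idP/idP => [|/eqP->]; last by rewrite qH0.
by apply: contraTT => /(ip_gt0 HH)/gt_eqF ->.
Qed.
Lemma nH_eq0 x : (nH x == 0) = (x == 0).
Proof. by rewrite -qH_eq0 -nH_sqr sqrf_eq0. Qed.
Lemma qHZ a x : qH (a *: x) = nK a ^+ 2 * qH x.
Proof.
by rewrite {1}/qH ipZl ipZr ip_qH mulrA nK_cjM -rmorphM re_toK.
Qed.
Lemma nHZ a x : nH (a *: x) = nK a * nH x.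
Proof. by rewrite /nH qHZ sqrtrM ?sqr_ge0// sqrtr_sqr ger0_norm// nK_ge0. Qed.
Lemma nHN x : nH (- x) = nH x.
Proof.
rewrite -scaleN1r nHZ; have -> : (-1 : K) = toK (-1) by rewrite rmorphN1.
by rewrite nK_toK normrN1 mul1r.
Qed.
Lemma nHB x y : nH (x - y) = nH (y - x).
Proof. by rewrite -nHN opprB. Qed.

Definition rip x y := re (ip x y).
Lemma ripD x y z : rip (x + y) z = rip x z + rip y z.
Proof. by rewrite /rip ipDl raddfD. Qed.
Lemma ripC x y : rip x y = rip y x.
Proof. by rewrite /rip (ip_cj HH x y) re_cj. Qed.
Lemma ripZ t x y : rip (toK t *: x) y = t * rip x y.
Proof. by rewrite /rip ipZl re_toKM. Qed.
Lemma qHD x y : qH (x + y) = qH x + qH y + 2 * rip x y.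
Proof.
have := form_expand ripD ripC ripZ 1 x y; rewrite rmorph1 scale1r /rip -!/(qH _) => ->.
ring.
Qed.
Lemma nHD x y : nH (x + y) <= nH x + nH y.
Proof. exact: (form_triangle ripD ripC ripZ qH_ge0). Qed.

(** Reduces to the real inequality by rotating: the product of [cj (ip x y) *: x] with [y] is the
    real number [nK (ip x y) ^+ 2]. A common power of [nK (ip x y)] is then cancelled. *)
Lemma CS x y : nK (ip x y) <= nH x * nH y.
Proof.
have [->|a0] := eqVneq (ip x y) 0.
  by rewrite nK0 mulr_ge0 ?nH_ge0.
have := form_CS ripD ripC ripZ qH_ge0 (cj (ip x y) *: x) y.
rewrite {1}/rip ipZl mulrC nK_cjM re_toK {1}/rip -/(qH _) qHZ nK_cj.
rewrite /rip -/(qH _) -!nH_sqr -exprMn -exprMn.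
have ap : 0 < nK (ip x y) by rewrite lt_neqAle eq_sym nK_eq0 a0 nK_ge0.
rewrite ler_pXn2r ?nnegrE ?sqr_ge0 ?mulr_ge0 ?nK_ge0 ?nH_ge0//.
by rewrite expr2 -mulrA ler_pM2l.
Qed.

(** Each entry is compared with the later ones only, which suits induction on the list; conjugate
    symmetry gives the other products. *)
Fixpoint orthonorm s : Prop :=
  if s is e :: s' then
    [/\ ip e e = 1, forall x, x \in s' -> ip e x = 0 & orthonorm s']
  else True.

Definition perp s x := forall e, e \in s -> ip x e = 0.

Lemma perp_cons e s x : perp (e :: s) x <-> ip x e = 0 /\ perp s x.
Proof.
split=> [h|[h1 h2] f].
  by split; [apply: h; rewrite mem_head | move=> f fs; apply: h; rewrite inE fs orbT].
by rewrite inE => /orP[/eqP->//|]; apply: h2.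
Qed.

Lemma unit_nH e : ip e e = 1 -> nH e = 1.
Proof.
move=> h; rewrite /nH /qH h -(rmorph1 toK) re_toK; exact: sqrtr1.
Qed.

Lemma normalize x : x != 0 -> exists2 a, a != 0 & ip (a *: x) (a *: x) = 1.
Proof.
move=> x0; have n0 : nH x != 0 by rewrite nH_eq0.
exists (toK (nH x)^-1); first by rewrite fmorph_eq0 invr_eq0.
by rewrite ip_qH qHZ nK_toK ger0_norm ?invr_ge0 ?nH_ge0// -nH_sqr -exprMn mulVf// expr1n rmorph1.
Qed.

(** Removing from [x] its component along the first vector leaves the other coefficients unchanged,
    and Pythagoras accounts for the part removed. *)
Lemma bessel s x : orthonorm s -> \sum_(e <- s) nK (ip x e) ^+ 2 <= qH x.
Proof.
elim: s x => [x _|e s IH x [e1 es os]]; first by rewrite big_nil qH_ge0.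
rewrite big_cons; set a := ip x e.
have ze : ip (x - a *: e) e = 0 by rewrite ipBl ipZl e1 mulr1 subrr.
have -> : qH x = nK a ^+ 2 + qH (x - a *: e).
  have {1}-> : x = a *: e + (x - a *: e) by rewrite addrC subrK.
  rewrite (qHD (a *: e)) qHZ.
  have -> : qH e = 1 by rewrite -nH_sqr unit_nH// expr1n.
  rewrite mulr1 ripC /rip ipZr ze mulr0 raddf0 mulr0 addr0//.
rewrite lerD2l; apply: le_trans (IH _ os).
rewrite le_eqVlt; apply/orP; left; apply/eqP; apply: eq_big_seq => f fs.
by rewrite ipBl ipZl es// mulr0 subr0.
Qed.

Lemma proj_perp s x : orthonorm s -> perp s (x - \sum_(e <- s) ip x e *: e).
Proof.
elim: s x => [//|e s IH x [e1 es os]]; apply/perp_cons.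
rewrite big_cons; split; last first.
  have h := IH (x - ip x e *: e) os.
  move=> f fs; rewrite opprD addrA -(h f fs); congr ip; congr (_ - _).
  by apply: eq_big_seq => g gs; rewrite ipBl ipZl es// mulr0 subr0.
rewrite ipBl ipDl ipZl e1 mulr1 ip_suml big_seq big1 ?addr0 ?subrr// => f fs.
by rewrite ipZl (ip_cj HH e f) es// rmorph0 mulr0.
Qed.

Lemma expansion_span s x : x = \sum_(e <- s) ip x e *: e -> span_seq s x.
Proof. by move=> h; exists (fun i => ip x s`_i); rewrite {1}h (big_nth 0) big_mkord. Qed.

Lemma lin_subspace_sum (M : set H) s (c : H -> K) : lin_subspace M ->
  (forall x, x \in s -> M x) -> M (\sum_(e <- s) c e *: e).
Proof.
move=> [M0 [MD MZ]] h; rewrite big_seq; elim/big_ind: _ => // e es.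
by apply: MZ; apply: h.
Qed.

Lemma lin_subspaceB (V : lmodType K) (M : set V) (x y : V) : lin_subspace M -> M x -> M y -> M (x - y).
Proof. by move=> [M0 [MD MZ]] Mx My; rewrite -scaleN1r; apply: MD => //; apply: MZ. Qed.

(** Greedy Gram-Schmidt inside [M]. When no nonzero vector of [M] is perpendicular to the list, the
    residual of each vector of [M] after projection must vanish, so the list expands all of [M]. *)
Lemma long_or_spanned (M : set H) : lin_subspace M ->
  (exists s, [/\ orthonorm s, forall x, x \in s -> M x &
     forall x, M x -> x = \sum_(e <- s) ip x e *: e]) \/
  (forall n, exists s, [/\ orthonorm s, forall x, x \in s -> M x & size s = n]).
Proof.
move=> sM; case: (pselect (exists s, [/\ orthonorm s, forall x, x \in s -> M x &
   forall x, M x -> x = \sum_(e <- s) ip x e *: e])) => [|no]; [by left|right].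
elim=> [|n [s [os Ms ss]]]; first by exists [::].
case: (pselect (exists x, [/\ M x, perp s x & x != 0])) => [[x [Mx px x0]]|nx].
  have [a a0 ax] := normalize x0.
  exists ((a *: x) :: s); split; rewrite /= ?ss//.
  - by split => // y ys; rewrite ipZl px// mulr0.
  - by move=> y; rewrite inE => /orP[/eqP->|/Ms//]; case: sM => _ [_]; apply.
case: no; exists s; split=> // x Mx; apply/eqP; rewrite -subr_eq0.
apply/negPn/negP => n0; apply: nx; exists (x - \sum_(e <- s) ip x e *: e); split=> //.
  by apply: lin_subspaceB => //; apply: lin_subspace_sum.
exact: proj_perp.
Qed.

(** * Norms bounded below on complements of finite codimension *)

Definition coercive_on (p : H -> R) (W : set H) :=
  exists2 c : R, 0 < c & forall x, W x -> c * nH x <= p x.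

Section Coercive.
Variables (p : H -> R) (C : R).
Hypothesis pD : forall x y, p (x + y) <= p x + p y.
Hypothesis pZ : forall a x, p (a *: x) = nK a * p x.
Hypothesis pC : forall x, p x <= C * nH x.
Hypothesis p0 : forall x, p x = 0 -> x = 0.

Lemma seminorm_ge0 x : 0 <= p x.
Proof.
have pN : p (- x) = p x by rewrite -scaleN1r pZ -[-1](rmorphN1 toK) nK_toK normrN1 mul1r.
have := pD x (- x); rewrite subrr pN.
have -> : p 0 = 0 by rewrite -(scale0r (0 : H)) pZ nK0 mul0r.
lra.
Qed.

(** The vectors of [s] are given back one at a time. Read in the contrapositive, a norm [p] that is
    not bounded below by a multiple of [nH] already fails to be so on the complement of any finite
    orthonormal list. *)
Lemma coercive_perp s : orthonorm s -> coercive_on p (perp s) ->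
  coercive_on p setT.
Proof.
have C0 : 0 <= `|C| by [].
have pC' x : p x <= `|C| * nH x.
  by apply: le_trans (pC x) _; rewrite ler_wpM2r ?nH_ge0 ?ler_norm.
elim: s => [_ [c c0 h]|e s IH [e1 es os] [c c0 h]].
  by exists c => // x _; apply: h.
apply: IH => //.
have pB x y : p (x - y) <= p x + p y.
  rewrite (le_trans (pD _ _))// -scaleN1r pZ.
  by rewrite -(rmorphN1 toK) nK_toK normrN1 mul1r.
(* the [p]-distance from [e] to the complement is positive, by completeness *)
have [eta eta0 heta] : exists2 eta : R, 0 < eta & forall z, perp (e :: s) z -> eta <= p (e + z).
  apply: contrapT => no.
  have hz i : exists z, perp (e :: s) z /\ p (e + z) < i.+1%:R^-1.
    apply: contrapT => nz; apply: no; exists (i.+1%:R^-1); rewrite ?invr_gt0// => z pz.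
    by rewrite leNgt; apply/negP => lt; apply: nz; exists z.
  have {hz}[z hz] := choice hz.
  have small (d : R) : 0 < d -> exists N, forall i, (N <= i)%N -> i.+1%:R^-1 < d.
    move=> d0; exists (Num.bound d^-1) => i le; rewrite -[d]invrK ltf_pV2 ?posrE ?invr_gt0//.
    have := archi_boundP (ltW (_ : 0 < d^-1)); rewrite invr_gt0 => /(_ d0) /lt_le_trans; apply.
    by rewrite ler_nat (leq_trans le).
  (* [z] is Cauchy: [c * nH (z i - z j)] is at most [p (z i - z j)], hence at most
     [p (e + z i) + p (e + z j)]. *)
  have [|l hl] := @ip_complete _ _ _ _ HH z.
    move=> d d0; have cd0 : 0 < c * d / 2 by rewrite divr_gt0 ?mulr_gt0.
    have [N hN] := small _ cd0.
    exists N => i j iN jN; rewrite -/(qH _) -/(nH _) -(ltr_pM2l c0).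
    apply: le_lt_trans (h _ _) _.
      by move=> f fs; rewrite ipBl !(proj1 (hz _)) ?subrr.
    have -> : z i - z j = (e + z i) - (e + z j) by rewrite opprD addrACA subrr add0r.
    apply: le_lt_trans (pB _ _) _.
    rewrite [ltRHS]splitr; apply: ltrD; [exact: lt_trans (hz i).2 (hN i iN)|exact: lt_trans (hz j).2 (hN j jN)].
  (* [p] is continuous for [nH] by [pC], and [p (e + z i)] tends to 0. *)
  have pel : p (e + l) = 0.
    apply/eqP; rewrite eq_le seminorm_ge0 andbT; apply/ler_addgt0Pr => d d0; rewrite add0r.
    have C1 : 0 < `|C| + 1 by rewrite ltr_wpDl.
    have d2 : 0 < d / 2 by rewrite divr_gt0.
    have d2C : 0 < d / 2 / (`|C| + 1) by rewrite divr_gt0.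
    have [N hN] := small _ d2.
    have [N' hN'] := hl _ d2C.
    set i := maxn N N'.
    have -> : e + l = (e + z i) - (z i - l) by rewrite opprB addrAC addrA addrNK addrC.
    apply: le_trans (pB _ _) _.
    have /hN h1 : (N <= i)%N by exact: leq_maxl.
    have /hN' h2 : (N' <= i)%N by exact: leq_maxr.
    have h3 := proj2 (hz i); have h4 := pC' (z i - l).
    rewrite -/(qH _) -/(nH _) ltr_pdivlMr// mulrC in h2.
    rewrite [d]splitr lerD//; first exact: ltW (lt_trans h3 h1).
    apply: le_trans h4 _; apply: le_trans (ltW h2).
    by rewrite ler_wpM2r ?nH_ge0// lerDl.
  (* Hence [l = - e], whereas every [z i] is orthogonal to [e]: the product of [z N - l] with [e] is
     1, although [nH (z N - l) < 1]. *)
  have /eqP := p0 pel; rewrite addrC addr_eq0 => /eqP le.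
  have [N hN] := hl 1 ltr01.
  have := hN N (leqnn _); rewrite -/(qH _) -/(nH _).
  have : nK (ip (z N - l) e) <= nH (z N - l) by rewrite (le_trans (CS _ _))// (unit_nH e1) mulr1.
  rewrite ipBl (proj1 (hz N)) ?mem_head// le ipNl e1 opprK add0r nK1 => a b.
  by have := le_lt_trans a b; rewrite ltxx.
have pe := seminorm_ge0 e.
(* This constant collects, for the splitting [x = a *: e + z], the bounds [nK a <= p x / eta] and
   [nH z <= (p x + nK a * p e) / c]. *)
have D0 : 0 < eta^-1 + c^-1 + p e / (eta * c).
  by rewrite ltr_pwDl ?addr_gt0 ?invr_gt0// divr_ge0// ltW// mulr_gt0.
exists ((eta^-1 + c^-1 + p e / (eta * c))^-1); first by rewrite invr_gt0.
move=> x px; set a := ip x e; set z := x - a *: e.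
have pz : perp (e :: s) z.
  apply/perp_cons; rewrite ipBl ipZl e1 mulr1 subrr; split=> // f fs.
  by rewrite ipBl ipZl es// mulr0 subr0 px.
have xE : x = a *: e + z by rewrite addrC subrK.
have h1 : nK a * eta <= p x.
  have [->|a0] := eqVneq a 0; first by rewrite nK0 mul0r seminorm_ge0.
  have -> : x = a *: (e + a^-1 *: z) by rewrite scalerDr scalerA divff// scale1r.
  rewrite pZ ler_wpM2l ?nK_ge0//; apply: heta => f fs.
  by rewrite ipZl pz// mulr0.
have h2 : nH x <= nK a + nH z.
  by rewrite {1}xE (le_trans (nHD _ _))// nHZ (unit_nH e1) mulr1.
have h3 := h z pz.
have h4 : p z <= p x + nK a * p e by rewrite -pZ pB.
have h5 : nK a <= p x / eta by rewrite ler_pdivlMr.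
have h6 : nH z <= (p x + nK a * p e) / c.
  by rewrite ler_pdivlMr// mulrC; apply: le_trans h4.
rewrite mulrC ler_pdivrMr//.
apply: le_trans h2 _; apply: le_trans (lerD h5 h6) _.
have -> : p x * (eta^-1 + c^-1 + p e / (eta * c)) = p x / eta + (p x + p x / eta * p e) / c.
  by field; rewrite !gt_eqF.
apply: lerD => //; apply: ler_wpM2r; first by rewrite invr_ge0 ltW.
by apply: lerD => //; apply: ler_wpM2r.
Qed.
End Coercive.
End HilbertTheory.

(** * Weak recurrence of isometries *)

Section BanachLimit.
Variable R : realType.
Implicit Types (a b : nat -> R).

Definition bdd a := exists M : R, forall n, `|a n| <= M.

Definition cesaro a n : R := (\sum_(k < n.+1) a k) / n.+1%:R.

Lemma cesaro_norm_le a M n : (forall k, `|a k| <= M) -> `|cesaro a n| <= M.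
Proof.
move=> h; rewrite /cesaro normrM [X in _ * X]ger0_norm ?invr_ge0// ler_pdivrMr ?ltr0Sn//.
apply: le_trans (ler_norm_sum _ _ _) _.
have -> : M * n.+1%:R = \sum_(k < n.+1) M by rewrite sumr_const card_ord mulr_natr.
exact: ler_sum.
Qed.

Lemma cesaroD a b n : cesaro (fun k => a k + b k) n = cesaro a n + cesaro b n.
Proof. by rewrite /cesaro big_split mulrDl. Qed.

Lemma cesaroZ t a n : cesaro (fun k => t * a k) n = t * cesaro a n.
Proof. by rewrite /cesaro -mulr_sumr mulrA. Qed.

Lemma cesaro_shift a n :
  cesaro (fun k => a k.+1) n = cesaro a n + (a n.+1 - a 0%N) / n.+1%:R.
Proof.
rewrite /cesaro -mulrDl; congr (_ / _); have h : a 0%N + \sum_(i < n.+1) a i.+1 = \sum_(i < n.+1) a i + a n.+1.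
  by transitivity (\sum_(i < n.+2) a i); [rewrite [RHS]big_ord_recl|rewrite [LHS]big_ord_recr].
by apply: (addrI (a 0%N)); rewrite h; ring.
Qed.

(** The Cesàro means of a bounded sequence stay in a compact interval, so they converge along a
    fixed ultrafilter finer than [\oo]. Shift invariance holds because a shift changes the n-th mean
    by a term of order [1 / n]. *)
Lemma banach_limit : exists L : (nat -> R) -> R,
  [/\ forall a b, bdd a -> bdd b -> L (fun n => a n + b n) = L a + L b,
      forall t a, bdd a -> L (fun n => t * a n) = t * L a,
      forall a b, bdd a -> bdd b -> (forall n, a n <= b n) -> L a <= L b,
      forall t, L (fun=> t) = t &
      forall a, bdd a -> L (fun n => a n.+1) = L a].
Proof.
have [U [UU sU]] := ultraFilterLemma (eventually_filter : ProperFilter \oo).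
have cv a : bdd a -> cvg (cesaro a @ U).
  move=> [M hM]; have UI : (cesaro a @ U) `[(- M), M]%classic.
    apply: (@filterS _ U _ setT _ _ filterT) => n _ /=; rewrite in_itv/= -ler_norml.
    exact: cesaro_norm_le.
  have [l [_ cl]] := @segment_compact R (- M) M (cesaro a @ U) _ UI.
  apply/cvg_ex; exists l => W Wl.
  have [//|nW] := in_ultra_setVsetC (cesaro a @^-1` W) UU.
  by have [y [/=]] := cl (~` W) _ nW Wl.
exists (fun a => lim (cesaro a @ U)); split.
- move=> a b ba bb; rewrite -limD; [|exact: cv|exact: cv].
  by congr (lim (_ @ U)); apply/funext => n; rewrite cesaroD.
- move=> t a ba; apply/cvg_lim => //.
  rewrite (_ : cesaro _ = fun n => t * cesaro a n); last first.
    by apply/funext => n; rewrite cesaroZ.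
  by apply: cvgM; [exact: cvg_cst|exact: cv].
- move=> a b ba bb ab; apply: ler_lim; [exact: cv|exact: cv|].
  near=> n; rewrite /cesaro ler_wpM2r ?invr_ge0//; apply: ler_sum => k _; exact: ab.
- move=> t; apply/cvg_lim => //; rewrite (_ : cesaro _ = fun=> t); first exact: cvg_cst.
  by apply/funext => n; rewrite /cesaro sumr_const card_ord -(mulr_natr t) mulfK// pnatr_eq0.
- move=> a ba; apply/cvg_lim => //.
  rewrite (_ : cesaro _ = fun n => cesaro a n + (a n.+1 - a 0%N) / n.+1%:R); last first.
    by apply/funext => n; rewrite cesaro_shift.
  rewrite -[X in _ --> X]addr0; apply: cvgD; first exact: cv.
  have : (fun n => (a n.+1 - a 0%N) / n.+1%:R) @ \oo --> (0 : R).
    case: ba => M hM; apply/norm_cvg0P.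
    have h : (fun n => (M + M) * (n.+1%:R)^-1) @ \oo --> (0 : R).
      rewrite -[X in _ --> X](mulr0 (M + M)); apply: cvgM; [exact: cvg_cst|exact: cvg_harmonic].
    apply: squeeze_cvgr h; last exact: cvg_cst.
    near=> n; rewrite normr_ge0 normrM [X in _ * X]ger0_norm ?invr_ge0//.
    by rewrite ler_wpM2r ?invr_ge0// (le_trans (ler_normB _ _))// lerD.
  by apply: cvg_trans => A; apply: sU.
Unshelve. all: by end_near.
Qed.
End BanachLimit.

(** * Invariant quadratic forms of finite trace *)

Section TraceForm.
Context {R : realType} {K : numFieldType} {S : scalars R K} {H : lmodType K}.
Variables (HH : hilbert S H) (V : H -> H).
Local Notation toK := (toK S).
Local Notation re := (re S).
Local Notation cj := (cj S).
Local Notation nK := (nK S).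
Local Notation ip := (ip HH).
Local Notation nH := (nH HH).
Local Notation qH := (qH HH).
Hypothesis V_qH : forall x, qH (V x) = qH x.
Hypothesis V_irr : forall M : set H, lin_subspace M -> fin_dim M ->
  (forall h, M h -> M (V h)) -> M = [set 0] \/ M = [set: H].
Hypothesis H_long : forall n, exists s, orthonorm HH s /\ size s = n.

Variables (B : H -> H -> R) (T : R).
Hypothesis BD : forall x y z, B (x + y) z = B x z + B y z.
Hypothesis BC : forall x y, B x y = B y x.
Hypothesis BZ : forall t x y, B (toK t *: x) y = t * B x y.
Hypothesis BK : forall a x, B (a *: x) (a *: x) = nK a ^+ 2 * B x x.
Hypothesis B_ge0 : forall x, 0 <= B x x.
Hypothesis B_trace : forall s, orthonorm HH s -> \sum_(e <- s) B e e <= T.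
Hypothesis BV : forall x, B (V x) (V x) = B x x.

(* A nonzero form would attain its maximum on the unit sphere; the maximizers
   span a V-invariant subspace, of finite dimension because of the trace bound. *)
Lemma trace_form_eq0 x : B x x = 0.
Proof.
apply/eqP/negPn/negP => Bx0.
have T_count s c : orthonorm HH s -> (forall e, e \in s -> c <= B e e) ->
  c *+ size s <= T.
  move=> os h; apply: le_trans (B_trace os).
  elim: s h {os} => [|e s IH] h; first by rewrite big_nil.
  rewrite big_cons mulrS lerD ?h ?mem_head// IH// => f fs.
  by rewrite h// inE fs orbT.
(* The trace bound allows at most [T / c] orthonormal vectors on which [B] is at least [c]. All
   contradictions below come from this. *)
have bounded_size (c : R) (P : H -> Prop) : 0 < c -> (forall e, P e -> nH e = 1 -> c <= B e e) ->
  ~ forall n, exists s, [/\ orthonorm HH s, forall x, x \in s -> P x & size s = n].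
  move=> c0 hP /(_ (Num.bound (T / c))) [s [os Ps ss]].
  have sU : forall e, e \in s -> ip e e = 1.
    elim: s os {Ps ss} => [//|f s IH [f1 _ os]] e; rewrite inE => /orP[/eqP->//|]; exact: IH.
  have := T_count s c os (fun e es => hP e (Ps e es) (unit_nH (sU e es))).
  rewrite -mulr_natr ss mulrC -ler_pdivlMr// => h1.
  have T0 : 0 <= T by have := B_trace (I : orthonorm HH [::]); rewrite big_nil.
  have := archi_boundP (divr_ge0 T0 (ltW c0)).
  by rewrite ltNge h1.
have B1 e : nH e = 1 -> B e e <= T.
  move=> e1; have := @B_trace [:: e]; rewrite big_seq1; apply; split => //.
  by rewrite ip_qH -nH_sqr e1 expr1n rmorph1.
have B0 : B 0 0 = 0 by rewrite -(scale0r 0) BK nK0 expr0n mul0r.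
pose A := [set B e e | e in [set e | nH e = 1]].
have xn0 : x != 0 by apply: contra Bx0 => /eqP ->; rewrite B0.
have unitB (y : H) : y != 0 -> exists2 e, nH e = 1 & B y y = qH y * B e e.
  move=> y0; exists (toK (nH y)^-1 *: y).
    by rewrite nHZ nK_toK ger0_norm ?invr_ge0 ?nH_ge0// mulVf// nH_eq0.
  rewrite BK nK_toK ger0_norm ?invr_ge0 ?nH_ge0// mulrA -nH_sqr -exprMn mulfV ?nH_eq0//.
  by rewrite expr1n mul1r.
have supA : has_sup A.
  split; first by have [e e1 _] := unitB x xn0; exists (B e e), e.
  by exists T => _ [e e1 <-]; apply: B1.
pose lam := sup A.
have B_le y : B y y <= lam * qH y.
  have [->|y0] := eqVneq y 0; first by rewrite B0 qH0 mulr0.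
  have [e e1 ->] := unitB y y0; rewrite mulrC ler_wpM2r ?qH_ge0//.
  by apply: ub_le_sup; [case: supA|exists e].
have lam0 : 0 < lam.
  have [e e1 hx] := unitB x xn0; have := B_le e; rewrite -nH_sqr e1 expr1n mulr1.
  apply: lt_le_trans; rewrite lt_neqAle B_ge0 andbT eq_sym.
  by apply: contra Bx0 => /eqP e0; rewrite hx e0 mulr0.
(* The defect of [B] from its supremum [lam] over unit vectors. It is semidefinite, so its null
   vectors [E] form a subspace: the eigenspace of [lam]. *)
pose g y z : R := lam * rip HH y z - B y z.
have gD a b c : g (a + b) c = g a c + g b c by rewrite /g ripD BD; ring.
have gC a b : g a b = g b a by rewrite /g ripC BC.
have gZ t a b : g (toK t *: a) b = t * g a b by rewrite /g ripZ BZ; ring.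
have g_ge0 a : 0 <= g a a by rewrite subr_ge0 B_le.
have gK a y : g (a *: y) (a *: y) = nK a ^+ 2 * g y y.
  rewrite /g BK; have -> : rip HH (a *: y) (a *: y) = nK a ^+ 2 * rip HH y y by exact: qHZ.
  by ring.
pose p y : R := Num.sqrt (g y y).
have pD a b : p (a + b) <= p a + p b by exact: form_triangle.
have pZ a y : p (a *: y) = nK a * p y.
  by rewrite /p gK sqrtrM ?sqr_ge0// sqrtr_sqr ger0_norm ?nK_ge0.
have pC y : p y <= Num.sqrt lam * nH y.
  rewrite /p /(nH y) -sqrtrM ?(ltW lam0)//; apply: ler_wsqrtr.
  by rewrite /g -/(qH y) gerBl.
have p_eq0 y : p y = 0 <-> g y y = 0.
  split=> [/eqP|h]; last by rewrite /p h sqrtr0.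
  by rewrite sqrtr_eq0 => h; apply/eqP; rewrite eq_le h g_ge0.
pose E := [set y | g y y = 0].
have linE : lin_subspace E.
  split; first by apply/p_eq0; rewrite -(scale0r 0) pZ nK0 mul0r.
  split=> [a b /p_eq0 pa /p_eq0 pb|a y /= h]; last by rewrite /E/= gK h mulr0.
  apply/p_eq0/eqP; rewrite eq_le sqrtr_ge0 andbT.
  by apply: le_trans (pD _ _) _; rewrite pa pb addr0.
have EV y : E y -> E (V y).
  by rewrite /E/= /g BV; have -> : rip HH (V y) (V y) = rip HH y y by exact: V_qH.
have E_B e : E e -> nH e = 1 -> lam <= B e e.
  move=> + e1; rewrite /E/= /g; have -> : rip HH e e = 1 by rewrite -(expr1n _ 2) -e1 nH_sqr.
  by rewrite mulr1 => /eqP; rewrite subr_eq0 => /eqP ->.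
have finE : fin_dim E.
  case: (long_or_spanned HH linE) => [[s [_ _ h]]|/(bounded_size lam E lam0 E_B)//].
  by exists s => y /h; exact: expansion_span.
(* If [E] were all of [H], orthonormal lists of every length would have [B e e >= lam]. *)
case: (V_irr linE finE EV) => [E0|ET]; last first.
  apply: (bounded_size lam E lam0 E_B) => n; have [s [os ss]] := H_long n.
  by exists s; split=> // y _; rewrite ET.
have p0 y : p y = 0 -> y = 0 by move=> /p_eq0 h; have : E y by []; rewrite E0.
(* With [E] zero, [p] is a norm. A lower bound [c] on the unit sphere would give
   [B e e <= lam - c ^+ 2] there, against the choice of [lam] as supremum. *)
have noC : ~ coercive_on HH p setT.
  move=> [c c0 h].
  have [|_ [e e1 <-]] := @sup_adherent R A (c ^+ 2) _ supA; first by rewrite exprn_gt0.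
  rewrite -/lam; have := h e I; rewrite e1 mulr1 -(ler_pXn2r (n := 2)) ?nnegrE ?sqrtr_ge0 ?(ltW c0)//.
  rewrite /p sqr_sqrtr// /g; have -> : rip HH e e = 1 by rewrite -(expr1n _ 2) -e1 nH_sqr.
  rewrite mulr1 => h1 h2; lra.
(* By [coercive_perp], the complement of any finite orthonormal list contains a unit vector with [p]
   below [Num.sqrt (lam / 2)], that is with [B] above [lam / 2]. Such lists can thus be prolonged
   indefinitely. *)
apply: (bounded_size (lam / 2) (fun e => lam / 2 <= B e e)) => //; first by rewrite divr_gt0.
elim=> [|n [s [os Bs ss]]]; first by exists [::].
apply: contrapT => no; apply: noC; apply: (coercive_perp pD pZ pC p0 os).
exists (Num.sqrt (lam / 2)); first by rewrite sqrtr_gt0 divr_gt0.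
move=> y py; have [->|y0] := eqVneq y 0; first by rewrite nH0 mulr0 sqrtr_ge0.
have [a a0 ya] := normalize HH y0.
rewrite leNgt; apply/negP => lt; apply: no; exists ((a *: y) :: s); split.
- by split=> // z zs; rewrite ipZl py// mulr0.
- move=> z; rewrite inE => /orP[/eqP->|/Bs//].
  have ap : 0 < nK a by rewrite lt_neqAle nK_ge0 eq_sym nK_eq0 a0.
  have : p (a *: y) < Num.sqrt (lam / 2).
    have := unit_nH ya; rewrite nHZ => n1; rewrite pZ.
    have -> : Num.sqrt (lam / 2) = nK a * (Num.sqrt (lam / 2) * nH y) by rewrite mulrCA n1 mulr1.
    by rewrite ltr_pM2l.
  rewrite -(ltr_pXn2r (n := 2)) ?nnegrE ?sqrtr_ge0// !sqr_sqrtr ?divr_ge0 ?(ltW lam0)//.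
  rewrite /g; have -> : rip HH (a *: y) (a *: y) = 1.
    by rewrite /rip ya -(rmorph1 toK) re_toK.
  by rewrite mulr1 => h; lra.
- by rewrite /= ss.
Qed.
End TraceForm.

Section Recurrence.
Context {R : realType} {K : numFieldType} {S : scalars R K} {H : lmodType K}.
Variables (HH : hilbert S H) (V : H -> H).
Local Notation toK := (toK S).
Local Notation re := (re S).
Local Notation cj := (cj S).
Local Notation nK := (nK S).
Local Notation ip := (ip HH).
Local Notation nH := (nH HH).
Local Notation qH := (qH HH).
Hypothesis V_ip : forall x y, ip (V x) (V y) = ip x y.
Hypothesis V_irr : forall M : set H, lin_subspace M -> fin_dim M ->
  (forall h, M h -> M (V h)) -> M = [set 0] \/ M = [set: H].
Hypothesis H_long : forall n, exists s, orthonorm HH s /\ size s = n.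

Lemma weak_recurrence w (hs : seq H) (e : R) N : 0 < e ->
  exists2 n, (N <= n)%N & forall h, h \in hs -> nK (ip (iter n V w) h) < e.
Proof.
move=> e0; apply: contrapT => no.
(* Failure is assumed only for exponents from [N] on, hence the shifted orbit. *)
pose a n := iter n V (iter N V w).
have {}no n : exists2 h, h \in hs & e <= nK (ip (a n) h).
  apply: contrapT => nh; apply: no; exists (n + N)%N; first by rewrite leq_addl.
  move=> h hh; rewrite ltNge; apply/negP => le; apply: nh; exists h => //.
  by rewrite /a -iterD.
have aq n : qH (a n) = qH (a 0%N).
  by elim: n => [//|n IH]; rewrite -IH /qH /a/= V_ip.
have [L [LD LZ L_le L_cst L_shift]] := banach_limit R.
(* Polarizes [nK (ip (a n) x) ^+ 2]. The Banach limit [B] inherits its trace bound from Bessel and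
   its [V]-invariance from shift invariance. *)
pose b x y n := re (ip (a n) x * cj (ip (a n) y)).
have bE x n : b x x n = nK (ip (a n) x) ^+ 2 by rewrite /b nK_cjM re_toK.
have bb x y : bdd (b x y).
  exists (nH (a 0%N) * nH x * (nH (a 0%N) * nH y)) => n.
  have nE : nH (a 0%N) = nH (a n) by rewrite /nH aq.
  apply: le_trans (re_le_nK S _) _; rewrite nKM nK_cj nE.
  by apply: ler_pM; rewrite ?nK_ge0// CS.
pose B x y := L (b x y).
have BD x y z : B (x + y) z = B x z + B y z.
  by rewrite /B -LD//; congr L; apply/funext => n; rewrite /b ipDr mulrDl raddfD.
have BC x y : B x y = B y x.
  by congr L; apply/funext => n; rewrite /b -[LHS]re_cj rmorphM cjK mulrC.
have BZ t x y : B (toK t *: x) y = t * B x y.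
  by rewrite /B -LZ//; congr L; apply/funext => n; rewrite /b ipZr cj_toK -mulrA re_toKM.
have BK c x : B (c *: x) (c *: x) = nK c ^+ 2 * B x x.
  rewrite /B -LZ//; congr L; apply/funext => n.
  by rewrite !bE ipZr nKM nK_cj exprMn.
have b0 : bdd (fun=> 0 : R) by exists 0 => n; rewrite normr0.
have B_ge0 x : 0 <= B x x.
  by rewrite -[leLHS]L_cst; apply: L_le => // n; rewrite bE sqr_ge0.
have LS s : bdd (fun n => \sum_(x <- s) b x x n) /\
    L (fun n => \sum_(x <- s) b x x n) = \sum_(x <- s) B x x.
  elim: s => [|x s [bs IH]].
    under eq_fun do rewrite big_nil.
    by rewrite big_nil L_cst.
  under eq_fun do rewrite big_cons.
  rewrite big_cons -IH -LD//; split=> //.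
  case: bs (bb x x) => M hM [M' hM']; exists (M' + M) => n.
  by apply: le_trans (ler_normD _ _) _; apply: lerD.
have cb c : bdd (fun=> c : R) by exists `|c|.
have trace s : orthonorm HH s -> \sum_(x <- s) B x x <= qH (a 0%N).
  move=> os; rewrite -(proj2 (LS s)) -[leRHS]L_cst; apply: L_le => // [|n]; first exact: (LS s).1.
  rewrite -(aq n); apply: le_trans (bessel (a n) os).
  by under eq_bigr do rewrite bE.
have BV x : B (V x) (V x) = B x x.
  rewrite /B -L_shift//; congr L; apply/funext => n.
  by rewrite !bE /a/= V_ip.
have V_qH x : qH (V x) = qH x by rewrite /qH V_ip.
have BZ0 := trace_form_eq0 V_qH V_irr H_long BD BC BZ BK B_ge0 trace BV.
(* At each time [n] some vector of [hs] has a product at least [e] with [a n], so the sum over [hs]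
   is at least [e ^+ 2] before and after the limit. *)
have : e ^+ 2 <= \sum_(x <- hs) B x x.
  rewrite -(proj2 (LS hs)) -[leLHS]L_cst; apply: L_le => // [|n]; first exact: (LS hs).1.
  have [h hh he] := no n; rewrite (big_rem h)//= bE.
  rewrite -[leLHS]addr0 lerD//.
    by rewrite ler_pXn2r ?nnegrE ?nK_ge0 ?(ltW e0).
  by apply: sumr_ge0 => x _; rewrite bE sqr_ge0.
rewrite big1 => [|x _]; last exact: BZ0.
by rewrite leNgt exprn_gt0.
Qed.
End Recurrence.

(** * Repetition schedule and almost orthogonal sequences *)

Section Schedule.
Variable R : realType.

(** Comparison with the harmonic series: [s + j * a] is at most [(j + 1) * (s + a)]. *)
Lemma sum_inv_affine_unbounded (s a M : R) : 0 < s -> 0 <= a ->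
  exists n, M <= \sum_(j < n) (s + j%:R * a)^-1.
Proof.
move=> s0 a0; have sa : 0 < s + a by rewrite ltr_wpDr.
apply: contrapT => no; apply: (@dvg_harmonic R).
apply: nondecreasing_is_cvgn.
  by apply: nondecreasing_series => n _ _; rewrite invr_ge0.
exists (M * (s + a)) => _ [n _ <-]; rewrite -ler_pdivrMr//.
rewrite leNgt; apply/negP => lt; apply: no; exists n; apply: ltW; apply: lt_le_trans lt _.
rewrite /series/= big_mkord mulr_suml; apply: ler_sum => j _.
rewrite /harmonic/= -invfM lef_pV2 ?posrE ?mulr_gt0 ?ltr_wpDr ?mulr_ge0//.
rewrite -natr1; have : (0 : R) <= j%:R by []. 
nra.
Qed.

(** Makes the 2-adic valuation a labelling of the stages that returns to each index at arbitrarily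
    late stages. *)
Lemma logn2_infinitely_often i N : exists2 n, (N <= n)%N & logn 2 n = i.
Proof.
exists (2 ^ i * N.*2.+1)%N.
  apply: (@leq_trans N.*2.+1); last by rewrite leq_pmull// expn_gt0.
  by rewrite -addnn -addnS leq_addr.
rewrite lognM ?expn_gt0// pfactorK// logn_coprime ?addn0//.
by rewrite coprime2n/= odd_double.
Qed.

Variable a : nat -> R.
Hypothesis a_ge0 : forall i, 0 <= a i.

(* Stages are run one after the other: the n-th stage repeats the same index
   until it has contributed at least n to the sum of the reciprocals. *)
Lemma schedule : exists phi : nat -> nat, forall i (M : R) k0, exists k n,
  [/\ (k0 <= k)%N, forall j, (j < n)%N -> phi (k + j)%N = i &
      M <= \sum_(j < n) (1 + \sum_(l < k + j) a (phi l))^-1].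
Proof.
(* [p] is a stage number with the value of the sum when the stage opens. The premise [0 < p.2] sits
   under the quantifier so that [choice] applies to all pairs. *)
have hN (p : nat * R) : exists n, 0 < p.2 ->
    p.1%:R <= \sum_(j < n.+1) (p.2 + j%:R * a (logn 2 p.1))^-1.
  case: (pselect (0 < p.2)) => [p0|]; last by exists 0%N.
  have [n hn] := sum_inv_affine_unbounded p.1%:R p0 (a_ge0 (logn 2 p.1)).
  exists n => _; apply: le_trans hn _; rewrite big_ord_recr/= lerDl invr_ge0.
  by rewrite addr_ge0 ?mulr_ge0// ltW.
have {hN}[N hN] := choice hN.
(* A state holds the stage, the repetitions still to come after the current one, and the sum so far.
   A stage opened with counter [N] therefore lasts [N.+1] steps. *)
pose step (x : nat * nat * R) := let s := x.2 + a (logn 2 x.1.1) in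
  if x.1.2 is r.+1 then (x.1.1, r, s) else (x.1.1.+1, N (x.1.1.+1, s), s).
pose f k := iter k step (0%N, N (0%N, 1), 1).
pose phi k := logn 2 (f k).1.1.
have fs k : (f k).2 = 1 + \sum_(l < k) a (phi l).
  elim: k => [|k IH]; first by rewrite big_ord0 addr0.
  rewrite big_ord_recr/= addrA -IH /phi /f/= -/(f k) /step.
  by case: (f k).1.2.
have run k st r s : f k = (st, r, s) -> forall j, (j <= r)%N ->
    f (k + j)%N = (st, (r - j)%N, s + j%:R * a (logn 2 st)).
  move=> fk; elim=> [_|j IH jr]; first by rewrite addn0 subn0 mul0r addr0.
  rewrite addnS /f/= -/(f _) IH ?(ltnW jr)// /step/= subnS.
  case: (r - j)%N (subn_gt0 j r) => [|m _/=]; first by rewrite jr.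
  by congr (_, _, _); rewrite -natr1; ring.
have start st : exists k s, [/\ (st <= k)%N, 0 < s & f k = (st, N (st, s), s)].
  elim: st => [|st [k [s [stk s0 fk]]]]; first by exists 0%N, 1.
  exists (k + N (st, s)).+1; eexists; split; last first.
  - by rewrite /f/= -/(f _) (run _ _ _ _ fk _ (leqnn _)) subnn /step/=.
  - by rewrite !ltr_wpDr ?mulr_ge0.
  - by rewrite ltnS (leq_trans stk)// leq_addr.
exists phi => i M k0.
(* A stage labelled [i] and numbered beyond both [k0] and [M] starts after [k0] and contributes at
   least [M]. *)
have [st hst sti] := logn2_infinitely_often i (maxn k0 (Num.bound M)).
have [k [s [stk s0 fk]]] := start st.
have rn j : (j < (N (st, s)).+1)%N -> f (k + j)%N = (st, (N (st, s) - j)%N, s + j%:R * a i).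
  by rewrite ltnS => /(run _ _ _ _ fk); rewrite sti.
exists k, (N (st, s)).+1; split.
- by rewrite (leq_trans _ stk)// (leq_trans _ hst)// leq_maxl.
- by move=> j /rn; rewrite /phi => ->.
- have := hN (st, s) s0; rewrite /= sti => h.
  apply: le_trans (le_trans _ h) _.
    have [M0|M0] := leP 0 M; last by rewrite (le_trans (ltW M0)).
    rewrite (le_trans (ltW (archi_boundP M0)))// ler_nat (leq_trans _ hst)// leq_maxr//.
  by apply: ler_sum => j _; rewrite -fs rn.
Qed.
End Schedule.

Section NearOrthogonal.
Context {R : realType} {K : numFieldType} {S : scalars R K} {H : lmodType K}.
Variables (HH : hilbert S H) (X : lmodType K) (F : set X) (j : X -> H).
Local Notation toK := (toK S).
Local Notation re := (re S).
Local Notation cj := (cj S).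
Local Notation nK := (nK S).
Local Notation ip := (ip HH).
Local Notation nH := (nH HH).
Local Notation qH := (qH HH).
Hypothesis linF : lin_subspace F.
Hypothesis j_lin : forall (a : K) x y, F x -> F y -> j (a *: x + y) = a *: j x + j y.

Lemma lin_on0 : j 0 = 0.
Proof.
have F0 := linF.1; have := j_lin 1 F0 F0; rewrite !scale1r addr0.
by move/eqP; rewrite -subr_eq0 opprD addrA subrr add0r oppr_eq0 => /eqP.
Qed.
Lemma lin_onD x y : F x -> F y -> j (x + y) = j x + j y.
Proof. by move=> Fx Fy; rewrite -[x in LHS]scale1r j_lin// scale1r. Qed.
Lemma lin_onZ a x : F x -> j (a *: x) = a *: j x.
Proof. by move=> Fx; rewrite -[_ *: _ in LHS]addr0 j_lin ?lin_on0 ?addr0//; exact: linF.1. Qed.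
Lemma lin_subspaceD x y : F x -> F y -> F (x + y). Proof. exact: linF.2.1. Qed.
Lemma lin_subspaceZ a x : F x -> F (a *: x). Proof. exact: linF.2.2. Qed.
Lemma lin_onB x y : F x -> F y -> j (x - y) = j x - j y.
Proof.
move=> Fx Fy; rewrite -scaleN1r addrC j_lin// scaleN1r addrC//.
Qed.

(* Evaluate [g] on the combination of the [x k] with conjugate coefficients:
   no Riesz representation of [g] is required. *)
Lemma near_orthogonal_bessel (g : {scalar X}) (C : R) (x : nat -> X) (s : nat -> R) n :
  0 <= C ->
  (forall y, F y -> nK (g y) <= C * nH (j y)) ->
  (forall k, F (x k)) -> (forall k, 1 <= s k) -> (forall k, qH (j (x k)) <= s k) ->
  (forall k l, (l < k)%N ->
     nK (ip (j (x k)) (j (x l))) <= 2^-1 ^+ k.+1 / k.+1%:R) ->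
  \sum_(k < n) nK (g (x k)) ^+ 2 / s k <= 2 * C ^+ 2.
Proof.
move=> C0 gC Fx s1 qs near.
have s0 k : 0 < s k by apply: lt_le_trans (s1 k).
pose c k := cj (g (x k)) * toK (s k)^-1.
have nc k : nK (c k) = nK (g (x k)) / s k.
  by rewrite nKM nK_cj nK_toK ger0_norm// invr_ge0 ltW.
have cC k : nK (c k) <= C.
  rewrite nc ler_pdivrMr//; apply: le_trans (gC _ (Fx k)) _.
  rewrite ler_wpM2l// -(ler_pXn2r (n := 2)) ?nnegrE ?nH_ge0 ?(ltW (s0 k))//.
  by rewrite nH_sqr (le_trans (qs k))// expr2 ler_peMl ?s1// ltW.
pose Y n := \sum_(k < n) c k *: x k.
have FY m : F (Y m).
  by rewrite /Y; elim/big_ind: _ => [|y z|k _]; [exact: linF.1|exact: lin_subspaceD|exact: lin_subspaceZ].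
have YS m : Y m.+1 = c m *: x m + Y m by rewrite /Y big_ord_recr/= addrC.
pose A n := \sum_(k < n) nK (g (x k)) ^+ 2 / s k.
have gY m : g (Y m) = toK (A m).
  rewrite /Y /A linear_sum rmorph_sum/=; apply: eq_bigr => k _.
  by rewrite linearZ/= /c mulrAC [_ * g _]mulrC nK_cjM -rmorphM.
have cross m y : (forall k, (k < m)%N -> nK (ip (j (x k)) y) <= 2^-1 ^+ m.+1 / m.+1%:R) ->
    nK (ip (j (Y m)) y) <= C * 2^-1 ^+ m.+1.
  move=> hy; have h l : (l <= m)%N -> nK (ip (j (Y l)) y) <= l%:R * (C * (2^-1 ^+ m.+1 / m.+1%:R)).
    elim: l => [_|l IH lm]; first by rewrite /Y big_ord0 lin_on0 ip0l nK0 mul0r.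
    rewrite YS j_lin// ip_lin; apply: le_trans (nKD _ _ _) _.
    rewrite -natr1 mulrDl mul1r addrC lerD ?IH ?(ltnW lm)// nKM.
    by apply: ler_pM; rewrite ?nK_ge0 ?hy.
  apply: le_trans (h m (leqnn m)) _.
  rewrite mulrCA ler_wpM2l// mulrCA -[leRHS]mulr1 ler_wpM2l ?exprn_ge0 ?invr_ge0//.
  by rewrite ler_pdivrMr ?ltr0Sn// mul1r ler_nat.
(* The diagonal terms sum to at most [A m]. The cross term of step [m] is at most
   [C ^+ 2 * 2^-1 ^+ m], which gives a geometric sum. *)
have qY m : qH (j (Y m)) <= A m + 2 * C ^+ 2 * (1 - 2^-1 ^+ m).
  elim: m => [|m IH]; first by rewrite /Y /A !big_ord0 lin_on0 qH0 expr0 subrr mulr0 addr0.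
  rewrite YS j_lin// qHD qHZ /A big_ord_recr/= -/(A m).
  have h1 : nK (c m) ^+ 2 * qH (j (x m)) <= nK (g (x m)) ^+ 2 / s m.
    rewrite nc exprMn -mulrA ler_wpM2l ?sqr_ge0// expr2 -mulrA -[leRHS]mulr1.
    by rewrite ler_wpM2l ?invr_ge0 ?(ltW (s0 m))// mulrC ler_pdivrMr// mul1r.
  have h2 : rip HH (c m *: j (x m)) (j (Y m)) <= C ^+ 2 * 2^-1 ^+ m.+1.
    apply: le_trans (ler_norm _) _; apply: le_trans (re_le_nK S _) _.
    rewrite ipZl nKM expr2 -mulrA; apply: ler_pM; rewrite ?nK_ge0//.
    rewrite ip_cj nK_cj; apply: cross => k km.
    by rewrite ip_cj nK_cj near.
  have e : 2^-1 ^+ m.+1 = 2^-1 * 2^-1 ^+ m :> R by rewrite exprS.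
  rewrite e in h2 *.
  lra.
have An : 0 <= A n.
  by apply: sumr_ge0 => k _; rewrite divr_ge0 ?sqr_ge0// ltW.
(* This says [(A n - 2 * C ^+ 2) * (A n + C ^+ 2) <= 0], whence the bound on [A n]. *)
have : (A n) ^+ 2 <= C ^+ 2 * (A n + 2 * C ^+ 2).
  rewrite [leLHS](_ : _ = nK (g (Y n)) ^+ 2); last by rewrite gY nK_toK ger0_norm.
  apply: (@le_trans _ _ ((C * nH (j (Y n))) ^+ 2)).
    by rewrite ler_pXn2r ?nnegrE ?nK_ge0 ?mulr_ge0 ?nH_ge0 ?gC.
  rewrite exprMn nH_sqr ler_wpM2l ?sqr_ge0//; apply: le_trans (qY n) _.
  have t0 : 0 <= 2^-1 ^+ n :> R by rewrite exprn_ge0// invr_ge0.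
  by have := mulr_ge0 (sqr_ge0 C) t0; lra.
rewrite -/(A n); have := sqr_ge0 C; nra.
Qed.
End NearOrthogonal.

(** * The inner product of the completion *)

Section RealNorm.
Context {R : realType} {K : numFieldType} (S : scalars R K).
Local Notation toK := (toK S).
Local Notation re := (re S).
Local Notation nK := (nK S).

Section Normed.
Variable X : normedModType K.
Implicit Types (x y : X) (u : nat -> X).

Definition nX x : R := re `|x|.

Lemma toK_nX x : toK (nX x) = `|x|.
Proof. by rewrite toK_re. Qed.
Lemma nX_ge0 x : 0 <= nX x.
Proof. by rewrite -(toK_ge0 S) toK_nX. Qed.
Lemma nX_eq0 x : nX x = 0 -> x = 0.
Proof. by move=> h; apply/eqP; rewrite -normr_eq0 -toK_nX h rmorph0. Qed.
Lemma nX0 : nX 0 = 0.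
Proof. by rewrite /nX normr0 raddf0. Qed.
Lemma nXD x y : nX (x + y) <= nX x + nX y.
Proof. by rewrite -(toK_le S) rmorphD/= !toK_nX ler_normD. Qed.
Lemma nXZ a x : nX (a *: x) = nK a * nX x.
Proof. by apply: (toK_inj (S := S)); rewrite rmorphM/= toK_nK !toK_nX normrZ. Qed.
Lemma nXN x : nX (- x) = nX x.
Proof. by rewrite /nX normrN. Qed.
Lemma nXB x y : nX (x - y) = nX (y - x).
Proof. by rewrite -nXN opprB. Qed.
Lemma re_gt0 (e : K) : 0 < e -> 0 < re e /\ toK (re e) = e.
Proof. by move=> e0; rewrite -(toK_gt0 S) toK_re ?ltW. Qed.

Lemma cvg_nX u x : (u @ \oo --> x) <->
  (forall e : R, 0 < e -> exists N, forall n, (N <= n)%N -> nX (u n - x) < e).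
Proof.
split=> [/cvgrPdist_lt h e e0|h].
  have [|N _ hN] := h (toK e); first by rewrite toK_gt0.
  by exists N => n /hN /=; rewrite -toK_nX toK_lt nXB.
apply/cvgrPdist_lt => e /re_gt0 [e0 <-]; have [N hN] := h _ e0.
by exists N => // n /hN; rewrite -toK_nX toK_lt nXB.
Qed.

Lemma dense_nX (A : set X) x (e : R) : dense A -> 0 < e -> exists2 a, A a & nX (a - x) < e.
Proof.
move=> dA e0; have := dA (ball x (toK e))° _ (open_interior _).
have te0 : 0 < toK e by rewrite toK_gt0.
case; first by exists x; apply: nbhsx_ballx.
move=> a [/interior_subset]; rewrite -ball_normE/= -toK_nX toK_lt => h Aa.
by exists a => //; rewrite nXB.
Qed.
End Normed.

Lemma complete_nX (X : completeNormedModType K) (u : nat -> X) :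
  (forall e : R, 0 < e -> exists N, forall i j, (N <= i)%N -> (N <= j)%N -> nX (u i - u j) < e) ->
  exists x : X, u @ \oo --> x.
Proof.
move=> h; apply/cvg_ex/cauchy_cvgP/cauchy_ballP => e /re_gt0[e0 <-].
have [N hN] := h _ e0.
pose A := [set x | exists2 n, (N <= n)%N & u n = x]; exists (A, A).
  by split; exists N => // n Nn; exists n.
move=> [_ _]/= [[m Nm <-] [n Nn <-]].
by rewrite -ball_normE/= -toK_nX toK_lt hN.
Qed.
End RealNorm.

Section Completion.
Context {R : realType} {K : numFieldType} (S : scalars R K).
Local Notation toK := (toK S).
Local Notation re := (re S).
Local Notation cj := (cj S).
Local Notation nK := (nK S).
Local Notation imu := (imu S).
Variables (X : lmodType K) (F : set X) (ip0 : X -> X -> K) (H : completeNormedModType K) (j : X -> H).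
Hypothesis linF : lin_subspace F.
Hypothesis ip0_inner : inner_product_on cj F ip0.
Hypothesis j_lin : forall (a : K) x y, F x -> F y -> j (a *: x + y) = a *: j x + j y.
Hypothesis j_norm : forall x, F x -> `|j x| ^+ 2 = ip0 x x.
Hypothesis j_dense : dense (j @` F).

Local Notation N h := (`|h| ^+ 2 : K).

(** Polarization for both fields: with [imu = 0] only the real identity remains. Using norms alone,
    it makes sense on all of [H] and is continuous. *)
Definition polar (x y : H) : K :=
  4^-1 * ((N (x + y) - N (x - y)) + imu * (N (x + imu *: y) - N (x - imu *: y))).

Lemma cvg_polar (x y : nat -> H) a b : x @ \oo --> a -> y @ \oo --> b ->
  (fun n => polar (x n) (y n)) @ \oo --> polar a b.
Proof.
have cN (u : nat -> H) c : u @ \oo --> c -> (fun n => N (u n)) @ \oo --> N c.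
  move=> uc; under eq_fun do rewrite expr2.
  by rewrite expr2; apply: cvgM; apply: cvg_norm.
move=> xa yb; apply: cvgM; first exact: cvg_cst.
have yi : (fun n => imu *: y n) @ \oo --> imu *: b by apply: cvgZ => //; exact: cvg_cst.
apply: cvgD; first by apply: cvgB; apply: cN; [apply: cvgD|apply: cvgB].
apply: cvgM; first exact: cvg_cst.
by apply: cvgB; apply: cN; [apply: cvgD|apply: cvgB].
Qed.

Lemma polar_j x y : F x -> F y -> polar (j x) (j y) = ip0 x y.
Proof.
have [ipl [ipc _]] := ip0_inner; have [F0 [FD FZ]] := linF.
have FN z : F z -> F (- z) by move=> Fz; rewrite -scaleN1r; apply: FZ.
move=> Fx Fy.
have ipD u v z : F u -> F v -> F z -> ip0 (u + v) z = ip0 u z + ip0 v z.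
  by move=> Fu Fv Fz; have := ipl 1 u v z Fu Fv Fz; rewrite scale1r mul1r.
have ip00 z : F z -> ip0 0 z = 0.
  by move=> Fz; have := ipD 0 0 z F0 F0 Fz; rewrite addr0 -[LHS]addr0 => /addrI.
have ipZ a u z : F u -> F z -> ip0 (a *: u) z = a * ip0 u z.
  by move=> Fu Fz; have := ipl a u 0 z Fu F0 Fz; rewrite addr0 ip00// addr0.
have sq u v a : F u -> F v -> N (j u + a *: j v) =
    ip0 u u + a * cj a * ip0 v v + (a * cj (ip0 u v) + cj a * ip0 u v).
  move=> Fu Fv; have Fav : F (a *: v) by exact: FZ.
  rewrite addrC -j_lin// j_norm; last exact: FD.
  rewrite ipD//; last exact: FD.
  rewrite ipZ//; last exact: FD.
  have c1 : ip0 v (a *: v + u) = cj a * ip0 v v + cj (ip0 u v).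
    rewrite (ipc (a *: v + u) v) ?ipD ?ipZ//; last exact: FD.
    by rewrite rmorphD rmorphM -ipc.
  have c2 : ip0 u (a *: v + u) = cj a * ip0 u v + ip0 u u.
    rewrite (ipc (a *: v + u) u) ?ipD ?ipZ//; last exact: FD.
    by rewrite rmorphD rmorphM -!ipc.
  by rewrite c1 c2; ring.
rewrite /polar sq//.
have := sq x y 1 Fx Fy; rewrite scale1r => ->.
have := sq x y (- 1) Fx Fy; rewrite scaleN1r => ->.
have := sq x y (- imu) Fx Fy; rewrite scaleNr => ->.
rewrite !rmorphN !rmorph1.
have h4 : (4 : K) != 0 by rewrite pnatr_eq0.
apply: (mulfI h4); rewrite mulrA divff// mul1r.
(* The square terms cancel, and what is left of the four norms is twice the right-hand side of
   [imuP] at [ip0 x y]. *)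
have := imuP S (ip0 x y) => e.
have -> : 4 * ip0 x y = 2 * (2 * ip0 x y) by ring.
by rewrite e; ring.
Qed.

Lemma completion_seq (h : H) : exists u : nat -> X,
  (forall n, F (u n)) /\ ((fun n => j (u n)) @ \oo --> h).
Proof.
have hu n : exists x, F x /\ nX S (j x - h) < n.+1%:R^-1.
  have [|_ [x Fx <-] hx] := dense_nX S h (e := n.+1%:R^-1) j_dense; first by rewrite invr_gt0.
  by exists x.
have {hu}[u hu] := choice hu; exists u; split=> [n|]; first exact: (hu n).1.
apply/(cvg_nX S) => e e0; exists (Num.bound e^-1) => n hn.
apply: lt_le_trans (hu n).2 _; rewrite -[e]invrK lef_pV2 ?posrE ?invr_gt0//.
apply: le_trans (ltW (archi_boundP _)) _; first by rewrite invr_ge0 ltW.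
by rewrite ler_nat leqW.
Qed.

Lemma cvg_cj (u : nat -> K) k : u @ \oo --> k -> (fun n => cj (u n)) @ \oo --> cj k.
Proof.
move=> /cvgrPdist_lt h; apply/cvgrPdist_lt => e e0.
have [M _ hM] := h e e0; exists M => // n /hM /=.
by rewrite -rmorphB -!(toK_nK S) nK_cj.
Qed.

(** True on the image of [F], where [polar] is [ip0]; both sides are continuous and the image is
    dense. *)
Lemma polar_lin a x y z : polar (a *: x + y) z = a * polar x z + polar y z.
Proof.
have [u [Fu ux]] := completion_seq x; have [v [Fv vy]] := completion_seq y; have [w [Fw wz]] := completion_seq z.
have h1 : (fun n => polar (a *: j (u n) + j (v n)) (j (w n))) @ \oo --> polar (a *: x + y) z.
  by apply: cvg_polar => //; apply: cvgD => //; apply: cvgZ => //; exact: cvg_cst.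
apply: (cvg_unique _ h1) => //.
rewrite (_ : (fun n => _) = fun n => a * polar (j (u n)) (j (w n)) + polar (j (v n)) (j (w n))).
  apply: cvgD; last exact: cvg_polar.
  by apply: cvgM; [exact: cvg_cst|exact: cvg_polar].
apply/funext => n; rewrite -j_lin// !polar_j//; last first.
  by apply: linF.2.1 => //; apply: linF.2.2.
by rewrite ip0_inner.1.
Qed.

Lemma polar_cj x y : polar y x = cj (polar x y).
Proof.
have [u [Fu ux]] := completion_seq x; have [v [Fv vy]] := completion_seq y.
apply: (cvg_unique _ (cvg_polar vy ux)) => //.
rewrite (_ : (fun n => _) = fun n => cj (polar (j (u n)) (j (v n)))).
  exact: cvg_cj (cvg_polar ux vy).
by apply/funext => n; rewrite !polar_j// ip0_inner.2.1.
Qed.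

Lemma polar_norm x : polar x x = `|x| ^+ 2.
Proof.
have [u [Fu ux]] := completion_seq x.
apply: (cvg_unique _ (cvg_polar ux ux)) => //.
rewrite (_ : (fun n => _) = fun n => `|j (u n)| * `|j (u n)|).
  by rewrite expr2; apply: cvgM; apply: cvg_norm.
by apply/funext => n; rewrite polar_j// -j_norm// expr2.
Qed.

Lemma sqrt_polar x : Num.sqrt (re (polar x x)) = nX S x.
Proof.
by rewrite polar_norm -(toK_nX S) -rmorphXn re_toK sqrtr_sqr ger0_norm ?nX_ge0.
Qed.

(** Transparent, because the next two lemmas compute its [ip] to [polar]. *)
Definition completion_hilbert : hilbert S H.
Proof.
apply: (@Hilbert _ _ _ _ polar polar_lin polar_cj).
  move=> x x0; rewrite polar_norm -(toK_nX S) -rmorphXn re_toK exprn_gt0//.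
  by rewrite -(toK_gt0 S) toK_nX normr_gt0.
move=> u hu; have [|x ux] := @complete_nX _ _ S H u.
  move=> e /hu [M hM]; exists M => i k iM kM; rewrite -sqrt_polar; exact: hM.
exists x => e e0; have [M hM] := (cvg_nX S u x).1 ux e e0.
by exists M => i /hM; rewrite sqrt_polar.
Defined.

Lemma nH_completion x : nH completion_hilbert x = nX S x.
Proof. exact: sqrt_polar. Qed.

(** [polar] is built from norms and linear operations, and [V] respects both. *)
Lemma ip_isometry (V : {linear H -> H}) : (forall h, `|V h| = `|h|) ->
  forall x y, ip completion_hilbert (V x) (V y) = ip completion_hilbert x y.
Proof.
move=> hV x y; rewrite /= /polar -linearZ -!linearD -!linearB !hV//.
Qed.
End Completion.

(** * Geometric smallness and bounds by homogeneity *)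

Lemma half_pow_small (R : realType) (C e : R) : 0 < e ->
  exists N, forall k, (N <= k)%N -> C * 2^-1 ^+ k < e.
Proof.
move=> e0; have := cvg_geometric `|C| (z := 2^-1 : R).
rewrite ger0_norm ?invr_ge0// invf_lt1 ?ltr1n// => /(_ isT).
move=> /cvgrPdist_lt /(_ e e0) [N _ hN]; exists N => k /hN /=.
rewrite sub0r normrN normrM normr_id => /le_lt_trans; apply.
by rewrite normrX (@ger0_norm _ 2^-1) ?invr_ge0// ler_wpM2r ?exprn_ge0 ?invr_ge0// ler_norm.
Qed.

Section Scaling.
Context {R : realType} {K : numFieldType} (S : scalars R K).

(** A vector violating the bound, rescaled to [p = 1], would have [q < d]. This turns continuity at
    0 into a linear bound, both for functionals on [X] and for the norm of [X] on [F]. *)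
Lemma bound_of_scaling (X : lmodType K) (F : set X) (p q : X -> R) (d : R) :
  (forall a x, F x -> F (a *: x)) ->
  (forall a x, F x -> p (a *: x) = nK S a * p x) ->
  (forall a x, F x -> q (a *: x) = nK S a * q x) ->
  (forall x, 0 <= q x) -> 0 < d ->
  (forall x, F x -> q x < d -> p x < 1) -> forall x, F x -> p x <= d^-1 * q x.
Proof.
move=> FZ pZ qZ q0 d0 h x Fx; rewrite leNgt; apply/negP => lt.
have px : 0 < p x by apply: le_lt_trans lt; rewrite mulr_ge0// invr_ge0 ltW.
have nKp : nK S (toK S (p x)^-1) = (p x)^-1 by rewrite nK_toK ger0_norm// invr_ge0 ltW.
have := h (toK S (p x)^-1 *: x) (FZ _ _ Fx).
rewrite pZ// qZ// nKp mulVf ?gt_eqF// ltxx => /(_ _)/notF; apply.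
by rewrite mulrC ltr_pdivrMr// -ltr_pdivrMl.
Qed.

Lemma scalar_bound (X : normedModType K) (f : {scalar X}) : continuous f ->
  exists2 C : R, 0 <= C & forall x, nK S (f x) <= C * nX S x.
Proof.
move=> /(_ 0)/cvgrPdist_lt /(_ 1 ltr01) /nbhs_ballP [e /= /(re_gt0 S)[d0 <-] h].
exists (re S e)^-1; first by rewrite invr_ge0 ltW.
move=> x; refine (@bound_of_scaling X setT (fun x => nK S (f x)) (@nX _ _ S X) (re S e) _ _ _ _ _ _ x I) => //.
- by move=> a y _; rewrite linearZ/= nKM.
- by move=> a y _; exact: nXZ.
- by move=> y; exact: nX_ge0.
move=> y _ yd; rewrite -(toK_lt S) rmorph1 toK_nK.
have /= := h y; rewrite -ball_normE/= sub0r normrN linear0 sub0r normrN.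
by rewrite -(toK_nX S) toK_lt; apply.
Qed.

Lemma scalars_bound (X : normedModType K) (f : nat -> {scalar X}) n :
  (forall i, continuous (f i)) ->
  exists2 C : R, 0 <= C & forall i x, (i < n)%N -> nK S (f i x) <= C * nX S x.
Proof.
move=> cf; elim: n => [|n [C C0 hC]]; first by exists 0.
have [D D0 hD] := scalar_bound (cf n); exists (C + D); first exact: addr_ge0.
move=> i x; rewrite ltnS leq_eqVlt mulrDl => /orP[/eqP->|/hC h].
  by apply: le_trans (hD x) _; rewrite lerDr mulr_ge0 ?nX_ge0.
by apply: le_trans (h x) _; rewrite lerDl mulr_ge0 ?nX_ge0.
Qed.
End Scaling.

(** * Infinite dimension of the completion *)

Section FiniteDimension.
Context {R : realType} {K : numFieldType} {S : scalars R K} {H : lmodType K}.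
Variables (HH : hilbert S H) (X : completeNormedModType K) (F : set X) (j : X -> H).
Local Notation nX := (nX S).
Local Notation nH := (nH HH).
Local Notation qH := (qH HH).
Local Notation ip := (ip HH).
Hypothesis X_inf : infinite_dimensional X.
Hypothesis linF : lin_subspace F.
Hypothesis F_dense : dense F.
Hypothesis j_lin : forall (a : K) x y, F x -> F y -> j (a *: x + y) = a *: j x + j y.
Hypothesis j_dense : forall h (e : R), 0 < e -> exists2 x, F x & nH (j x - h) < e.
Variable C : R.
Hypothesis j_bound : forall x, F x -> nX x <= C * nH (j x).

(* Otherwise [j] identifies F with a finite dimensional H; the two norms are then
   equivalent on F, so F is complete, hence equal to X. *)
Lemma long_orthonorm n : exists s, orthonorm HH s /\ size s = n.
Proof.
have lin_on0 := lin_on0 linF j_lin.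
have jF : lin_subspace (j @` F).
  split; first by exists 0; [exact: linF.1|exact: lin_on0].
  split=> [_ _ [x Fx <-] [y Fy <-]|a _ [x Fx <-]].
    by exists (x + y); [exact: lin_subspaceD|exact: (lin_onD j_lin Fx Fy)].
  by exists (a *: x); [exact: lin_subspaceZ|exact: (lin_onZ linF j_lin a Fx)].
case: (long_or_spanned HH jF) => [|/(_ n) [s [os _ ss]]]; last by exists s.
move=> [s [os Ms hs]]; exfalso.
(* The expansion extends from the image of [F] to [H]: the residual [u] is orthogonal to that image
   and also approximated by it. *)
have expand h : h = \sum_(e <- s) ip h e *: e.
  set u := h - \sum_(e <- s) ip h e *: e.
  suff : nH u = 0 by move/eqP; rewrite nH_eq0 subr_eq0 => /eqP.
  apply/eqP; rewrite eq_le nH_ge0 andbT; apply/ler_addgt0Pr => e e0; rewrite add0r.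
  have [x Fx xu] := j_dense u e0.
  have pu : perp HH s u by exact: proj_perp.
  have ipux : ip u (j x) = 0.
    rewrite (hs (j x)); last by exists x.
    rewrite ip_cj ip_suml big_seq big1 ?rmorph0// => f fs.
    by rewrite ipZl (ip_cj HH u f) pu// rmorph0 mulr0.
  have [->|u0] := eqVneq (nH u) 0; first exact: ltW.
  have un : 0 < nH u by rewrite lt_neqAle eq_sym u0 nH_ge0.
  rewrite -(ler_pM2l un) -expr2 nH_sqr /(qH u).
  have -> : ip u u = ip u (u - j x).
    by rewrite ipBr ipux subr0.
  apply: le_trans (ler_norm _) _; apply: le_trans (re_le_nK S _) _.
  by apply: le_trans (CS _ _ _) _; rewrite ler_wpM2l ?nH_ge0// nHB ltW.
have ex h : exists x, F x /\ j x = h.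
  have : (j @` F) h.
    by rewrite (expand h); apply: lin_subspace_sum.
  by case=> x Fx <-; exists x.
(* [r] will be the linear inverse of [j] on [F], injectivity coming from [j_bound]. *)
have {ex}[r hr] := choice ex.
have rF h := (hr h).1; have jr h := (hr h).2.
have j_inj x y : F x -> F y -> j x = j y -> x = y.
  move=> Fx Fy e; have := @j_bound (x - y) (lin_subspaceB linF Fx Fy).
  rewrite (lin_onB j_lin)// e subrr nH0 mulr0 => h; apply/eqP; rewrite -subr_eq0; apply/eqP.
  by apply: (nX_eq0 (S := S)); apply/eqP; rewrite eq_le h nX_ge0.
have r_lin a h k : r (a *: h + k) = a *: r h + r k.
  apply: j_inj; first exact: rF.
    by apply: lin_subspaceD => //; apply: lin_subspaceZ.
  by rewrite j_lin// !jr.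
have rD h k : r (h + k) = r h + r k by rewrite -[h in LHS]scale1r r_lin scale1r.
have r0 : r 0 = 0 by apply: j_inj; [exact: rF|exact: linF.1|rewrite jr lin_on0].
have rZ a h : r (a *: h) = a *: r h by rewrite -[_ *: h]addr0 r_lin r0 addr0.
(* Only 0 is perpendicular to [s], so coercivity is trivial there and [coercive_perp] carries it to
   [H]. *)
have [c c0 hc] : coercive_on HH (fun h => nX (r h)) setT.
  apply: (@coercive_perp _ _ _ _ HH _ C _ _ _ _ s os).
  - by move=> h k; rewrite rD nXD.
  - by move=> a h; rewrite rZ nXZ.
  - by move=> h; apply: le_trans (j_bound (rF h)) _; rewrite jr.
  - by move=> h /nX_eq0 e; rewrite -(jr h) e lin_on0.
  exists 1 => // h ph; rewrite (expand h) big_seq big1 ?nH0 ?mulr0 ?nX_ge0// => e es.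
  by rewrite ph// scale0r.
(* A sequence of [F] converging to [x] in [X] is Cauchy in [H] by coercivity; its limit [l]
   satisfies [r l = x] by [j_bound]. *)
have FX x : F x.
  have hu i : exists y, F y /\ nX (y - x) < 2^-1 ^+ i.
    by have [|y Fy yx] := dense_nX S x (e := 2^-1 ^+ i) F_dense; [rewrite exprn_gt0|exists y].
  have {hu}[u hu] := choice hu.
  have [|l hl] := @ip_complete _ _ _ _ HH (fun i => j (u i)).
    move=> e e0; have [N hN] := half_pow_small (2 / c) e0.
    exists N => i k iN kM; rewrite -/(qH _) -/(nH _).
    have hp n' : (N <= n')%N -> 2^-1 ^+ n' < e * c / 2 :> R.
      by move=> /hN; rewrite mulrAC ltr_pdivrMr// ltr_pdivlMr// mulrC.
    have := hc (j (u i) - j (u k)) I; rewrite -(lin_onB j_lin (hu i).1 (hu k).1).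
    have -> : r (j (u i - u k)) = u i - u k.
      have Fik : F (u i - u k) := lin_subspaceB linF (hu i).1 (hu k).1.
      by apply: j_inj; rewrite ?jr.
    have -> : u i - u k = (u i - x) - (u k - x) by rewrite opprB addrA subrK.
    move=> h; rewrite -(ltr_pM2l c0); apply: le_lt_trans h _; apply: le_lt_trans (nXD _ _ _) _.
    rewrite nXN mulrC [ltRHS]splitr; apply: ltrD.
      exact: lt_trans (hu i).2 (hp _ iN).
    exact: lt_trans (hu k).2 (hp _ kM).
  suff -> : x = r l by [].
  apply/eqP; rewrite -subr_eq0; apply/eqP/(nX_eq0 (S := S))/eqP.
  rewrite eq_le nX_ge0 andbT; apply/ler_addgt0Pr => e e0; rewrite add0r.
  have C1 : 0 < `|C| + 1 by rewrite ltr_wpDl.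
  have [|N hN] := hl (e / 2 / (`|C| + 1)); first by rewrite !divr_gt0.
  have [|N' hN'] := half_pow_small 1 (e := e / 2); first by rewrite divr_gt0.
  set i := maxn N N'.
  have /hN : (N <= i)%N by exact: leq_maxl.
  have /hN' : (N' <= i)%N by exact: leq_maxr.
  rewrite mul1r -/(qH _) -/(nH _) => h1; rewrite ltr_pdivlMr// => h2.
  have -> : x - r l = (u i - r l) - (u i - x) by rewrite opprB [RHS]addrC addrA subrK.
  apply: le_trans (nXD _ _ _) _; rewrite nXN [e]splitr; apply: lerD; last first.
    exact: ltW (lt_trans (hu i).2 h1).
  apply: le_trans (j_bound (lin_subspaceB linF (hu i).1 (rF l))) _.
  rewrite (lin_onB j_lin (hu i).1 (rF l)) jr; apply: le_trans (ltW h2); rewrite mulrC.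
  by rewrite ler_wpM2l ?nH_ge0// (le_trans (ler_norm _))// lerDl.
apply: X_inf; exists [seq r e | e <- s] => x _.
have -> : x = \sum_(e <- s) ip (j x) e *: r e.
  have {1}-> : x = r (j x) by apply: j_inj; rewrite ?jr.
  rewrite {1}(expand (j x)); elim: s {os Ms hs expand hc} => [|e s IH]; first by rewrite !big_nil r0.
  by rewrite !big_cons rD rZ IH.
exists (fun i => ip (j x) s`_i).
rewrite (big_nth 0) big_mkord size_map; apply: eq_bigr => i _.
by rewrite (nth_map 0).
Qed.
End FiniteDimension.

(** * The weakly dense orbit *)

Section Construction.
Context {R : realType} {K : numFieldType} {S : scalars R K} {H : lmodType K}.
Variables (HH : hilbert S H) (X : completeNormedModType K) (T : {linear X -> X}).
Variables (F : set X) (j : X -> H) (V : H -> H).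
Local Notation nX := (nX S).
Local Notation nK := (nK S).
Local Notation nH := (nH HH).
Local Notation qH := (qH HH).
Local Notation ip := (ip HH).
Hypothesis X_sep : separable X.
Hypothesis T_cont : continuous T.
Hypothesis linF : lin_subspace F.
Hypothesis F_dense : dense F.
Hypothesis TF : forall x, F x -> F (T x).
Hypothesis j_lin : forall (a : K) x y, F x -> F y -> j (a *: x + y) = a *: j x + j y.
Variable C : R.
Hypothesis C0 : 0 <= C.
Hypothesis j_bound : forall x, F x -> nX x <= C * nH (j x).
Hypothesis Vj : forall x, F x -> V (j x) = j (T x).
Hypothesis V_ip : forall x y, ip (V x) (V y) = ip x y.
Hypothesis V_rec : forall w (hs : seq H) (e : R) N, 0 < e ->
  exists2 n, (N <= n)%N & forall h, h \in hs -> nK (ip (iter n V w) h) < e.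
Hypothesis back : forall x, F x -> has_backward_orbit_to_0 T x.

Local Notation Tn n := (iter n T).

Lemma iter_lin n : (forall x y, Tn n (x + y) = Tn n x + Tn n y) /\
  (forall x y, Tn n (x - y) = Tn n x - Tn n y).
Proof.
elim: n => [//|n [hD hB]]; split=> x y /=; first by rewrite hD linearD.
by rewrite hB linearB.
Qed.
Lemma iter_linD n x y : Tn n (x + y) = Tn n x + Tn n y.
Proof. exact: (iter_lin n).1. Qed.
Lemma iter_linB n x y : Tn n (x - y) = Tn n x - Tn n y.
Proof. exact: (iter_lin n).2. Qed.

Lemma iter_F n x : F x -> F (Tn n x) /\ j (Tn n x) = iter n V (j x).
Proof.
by move=> Fx; elim: n => [//|n [IH1 IH2]] /=; split; [exact: TF|rewrite -Vj// IH2].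
Qed.

Lemma iter_cont n (u : nat -> X) x : u @ \oo --> x -> (fun k => Tn n (u k)) @ \oo --> Tn n x.
Proof.
by move=> ux; elim: n => [//|n IH] /=; apply: continuous_cvg => //; exact: T_cont.
Qed.

Lemma dense_targets : exists t : nat -> X, (forall i, F (t i)) /\
  forall x (e : R), 0 < e -> exists i, nX (t i - x) < e.
Proof.
have [d hd] := X_sep.
have ht i : exists y, F y /\
    nX (y - d (odflt (0, 0)%N (unpickle i)).1) < 2^-1 ^+ (odflt (0, 0)%N (unpickle i)).2.
  have [|y Fy h] := dense_nX S (d (odflt (0, 0)%N (unpickle i)).1) (e := 2^-1 ^+ (odflt (0, 0)%N (unpickle i)).2) F_dense.
    by rewrite exprn_gt0.
  by exists y.
have {ht}[t ht] := choice ht; exists t; split=> [i|x e e0]; first exact: (ht i).1.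
have e2 : 0 < e / 2 by rewrite divr_gt0.
have [_ [m _ <-] hm] := dense_nX S x hd e2.
have [N /(_ _ (leqnn N))] := half_pow_small 1 e2; rewrite mul1r => hN.
exists (pickle (m, N)); have := (ht (pickle (m, N))).2; rewrite pickleK/= => h.
have -> : t (pickle (m, N)) - x = (t (pickle (m, N)) - d m) + (d m - x) by rewrite addrA subrK.
apply: le_lt_trans (nXD _ _ _) _; rewrite [e]splitr; apply: ltrD => //.
exact: lt_trans h hN.
Qed.

(* [x] is the sum of the [N k]-th terms of backward orbits of the [y k], and
   [v k + y k] is the image of its k-th partial sum under [T^(N k)]. *)
Lemma orbit_sequence (y : nat -> X) : (forall k, F (y k)) ->
  exists (x : X) (N : nat -> nat) (v : nat -> X),
  [/\ forall k, F (v k),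
      forall k l, (l < k)%N -> nK (ip (j (v k)) (j (v l))) <= 2^-1 ^+ k.+1 / k.+1%:R,
      forall k, qH (j (v k)) <= 1 + \sum_(l < k) (qH (j (y l)) + 1) &
      forall k, nX (Tn (N k) x - (v k + y k)) <= 2^-1 ^+ k].
Proof.
move=> Fy; have F0 := linF.1.
pose eps k : R := 2^-1 ^+ k.+1 / k.+1%:R.
have eps0 k : 0 < eps k by rewrite divr_gt0 ?exprn_gt0.
have half0 : 0 <= 2^-1 :> R by rewrite invr_ge0.
have half1 : 2^-1 <= 1 :> R by rewrite invf_le1 ?ler1n.
have eps_half k : eps k <= 2^-1.
  rewrite ler_pdivrMr ?ltr0Sn// exprS ler_wpM2l//.
  by apply: (@le_trans _ _ 1); [rewrite exprn_ile1|rewrite ler1n].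
have [b hb] := choice (fun k => back (Fy k)).
have b0 k : b k 0%N = y k by exact: (hb k).1.
have bS k n : T (b k n.+1) = b k n by exact: (hb k).2.1.
have bn k n i : Tn n (b k (i + n)%N) = b k i.
  by elim: n i => [|n IH] i; [rewrite addn0|rewrite /= addnS -addSn IH bS].
have hM k : exists M, forall m, (M <= m)%N -> nX (b k m) <= 2^-1 ^+ k.
  have [|M h] := (cvg_nX S _ _).1 (hb k).2.2 (2^-1 ^+ k); first by rewrite exprn_gt0.
  by exists M => m /h; rewrite subr0 => /ltW.
have {hM}[M hM] := choice hM.
(* [p] holds a step [k] and the vectors found so far, latest first. The next target joins the
   directions to be avoided, so that [v k.+1] is almost orthogonal to [y k.+1] as well. *)
have hm (p : nat * seq X) : exists m, (forall z, z \in p.2 -> F z) ->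
    (M p.1.+1 <= m)%N /\ forall z, z \in y p.1.+1 :: p.2 ->
      nK (ip (j (Tn m (head 0 p.2 + y p.1))) (j z)) <= eps p.1.+1.
  case: (pselect (forall z, z \in p.2 -> F z)) => [Fp|]; last by exists 0%N.
  have [m Mm h] := V_rec (j (head 0 p.2 + y p.1)) [seq j z | z <- y p.1.+1 :: p.2] (M p.1.+1) (eps0 p.1.+1).
  exists m => _; split=> // z zp.
  rewrite (iter_F m _).2; first by rewrite ltW// h// map_f.
  by apply: lin_subspaceD => //; case: p.2 Fp => [//|z' s] /(_ z'); apply; exact: mem_head.
have {hm}[m hm] := choice hm.
(* [f k] consists of the exponent [N k] and the list from [v k] down to [v 0 = 0]. *)
pose f := fix f k : nat * seq X := if k is k'.+1 then
   let st := f k' in let n := m (k', st.2) in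
   ((st.1 + n)%N, Tn n (head 0 st.2 + y k') :: st.2) else (0%N, [:: 0]).
pose N k := (f k).1; pose v k := head 0 (f k).2; pose d k := m (k, (f k).2).
have fS k : f k.+1 = ((N k + d k)%N, Tn (d k) (v k + y k) :: (f k).2) by [].
have Ff k : forall z, z \in (f k).2 -> F z.
  elim: k => [|k IH] z; first by rewrite mem_seq1 => /eqP->.
  rewrite fS inE => /orP[/eqP->|/IH//]; apply: (iter_F _ _).1; apply: lin_subspaceD => //.
  by rewrite /v; case: (f k).2 IH => [//|z' s] /(_ z'); apply; exact: mem_head.
have vf l k : (l <= k)%N -> v l \in (f k).2.
  elim: k => [|k IH]; first by rewrite leqn0 => /eqP->; rewrite mem_seq1.
  rewrite leq_eqVlt => /orP[/eqP->|/IH h]; first by rewrite /v fS mem_head.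
  by rewrite fS inE h orbT.
have Fv k : F (v k) by apply: (Ff k); exact: vf.
have vS k : v k.+1 = Tn (d k) (v k + y k) by [].
have dP k : (M k.+1 <= d k)%N /\ forall z, z \in y k.+1 :: (f k).2 ->
    nK (ip (j (v k.+1)) (j z)) <= eps k.+1.
  exact: (hm (k, (f k).2) (Ff k)).
have lin_on0 := lin_on0 linF j_lin.
have vy k : nK (ip (j (v k)) (j (y k))) <= 2^-1.
  case: k => [|k]; first by rewrite lin_on0 ip0l nK0.
  by apply: le_trans (eps_half k.+1); apply: (dP k).2; rewrite mem_head.
have qiter n h : qH (iter n V h) = qH h.
  by elim: n => [//|n IH]; rewrite -IH /(qH _)/= V_ip.
(* Since [V] is isometric, the squared norm grows by that of [y k] and by twice a product of at most
   [2^-1]; this is the extra 1 in each summand. *)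
have qv k : qH (j (v k)) <= 1 + \sum_(l < k) (qH (j (y l)) + 1).
  elim: k => [|k IH]; first by rewrite lin_on0 qH0 big_ord0 addr0.
  rewrite vS (iter_F _ _).2; last exact: lin_subspaceD.
  rewrite qiter (lin_onD j_lin)// qHD big_ord_recr/=.
  have : rip HH (j (v k)) (j (y k)) <= 2^-1.
    by apply: le_trans (vy k); apply: le_trans (ler_norm _) _; exact: re_le_nK.
  lra.
pose u k := b k (N k); pose P n := \sum_(l < n) u l.
have PS n : P n.+1 = P n + u n by rewrite /P big_ord_recr.
have NS k : N k.+1 = (N k + d k)%N by [].
have TP k : Tn (N k) (P k.+1) = v k + y k.
  elim: k => [|k IH]; first by rewrite /P big_ord_recr big_ord0 add0r /= /u b0 add0r.
  rewrite PS iter_linD {1}NS addnC iterD IH -vS; congr (_ + _).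
  by rewrite /u -[N k.+1 in X in b _ X]add0n bn b0.
(* Each gap [d k] is at least [M k.+1], so [T^(N k)] sends [u l] to a term of index at least [M l]
   of the backward orbit of [y l]. *)
have NM k l : (k < l)%N -> exists2 i, (M l <= i)%N & N l = (i + N k)%N.
  elim: l => [//|l IH]; rewrite ltnS leq_eqVlt => /orP[/eqP->|/IH [i Mi e]].
    by exists (d l); [exact: (dP l).1|rewrite NS addnC].
  exists (i + d l)%N; last by rewrite NS e addnAC.
  exact: leq_trans (dP l).1 (leq_addl _ _).
have Tu k l : (k < l)%N -> nX (Tn (N k) (u l)) <= 2^-1 ^+ l.
  by move=> /NM[i Mi e]; rewrite /u e bn hM.
(* The right-hand side is the sum of [2^-l] over [k < l <= k + i]. *)
have tail k0 k i : (k0 <= k)%N ->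
    nX (Tn (N k0) (P (k.+1 + i)%N - P k.+1)) <= 2^-1 ^+ k - 2^-1 ^+ (k + i).
  move=> k0k; elim: i => [|i IH].
    by rewrite addn0 subrr -(subrr (0 : X)) iter_linB subrr nX0 addn0 subrr.
  rewrite addnS PS addrAC iter_linD; apply: le_trans (nXD _ _ _) _.
  have := Tu k0 (k.+1 + i)%N; rewrite addSn ltnS (leq_trans k0k (leq_addr _ _)) => /(_ isT) h.
  have e : 2^-1 ^+ (k + i).+1 = 2^-1 * 2^-1 ^+ (k + i) :> R by rewrite exprS.
  rewrite addnS e; rewrite e in h; rewrite addSn in IH; lra.
have pow0 n : 0 <= 2^-1 ^+ n :> R by rewrite exprn_ge0.
have [|x Px] := @complete_nX _ _ S X P.
  move=> e e0; have [n hn] := half_pow_small 2 e0; exists n.+1 => i k ni nk.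
  have h l : (n.+1 <= l)%N -> nX (P l - P n.+1) <= 2^-1 ^+ n.
    move=> /subnKC <-; apply: le_trans (tail 0%N n _ (leq0n _)) _.
    by rewrite gerBl.
  have -> : P i - P k = (P i - P n.+1) - (P k - P n.+1) by rewrite opprB addrA subrK.
  apply: le_lt_trans (nXD _ _ _) _; rewrite nXN; apply: le_lt_trans (hn n (leqnn _)).
  by rewrite mulr_natl mulr2n; apply: lerD; exact: h.
exists x, N, v; split=> // [k l lk|k].
  case: k lk => [//|k]; rewrite ltnS => lk.
  by apply: (dP k).2; rewrite inE vf// orbT.
apply/ler_addgt0Pr => e e0.
have [n hn] := (cvg_nX S _ _).1 (iter_cont (n := N k) Px) e e0.
pose i := (n - k.+1)%N.
have ni : (n <= k.+1 + i)%N by rewrite -leq_subLR.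
have -> : Tn (N k) x - (v k + y k) =
    (Tn (N k) (P (k.+1 + i)%N - P k.+1)) - (Tn (N k) (P (k.+1 + i)%N) - Tn (N k) x).
  by rewrite -TP iter_linB opprB [RHS]addrC addrA subrK.
apply: le_trans (nXD _ _ _) _; rewrite nXN; apply: lerD; last exact: ltW (hn _ ni).
by apply: le_trans (tail k k i (leqnn _)) _; rewrite gerBl.
Qed.

Lemma weak_hypercyclicity : weakly_hypercyclic T.
Proof.
have [t [Ft tD]] := dense_targets.
have [phi hphi] := schedule (fun i => addr_ge0 (qH_ge0 HH (j (t i))) ler01).
have [x [N [v [Fv near qv Tx]]]] := orbit_sequence (fun k => Ft (phi k)).
exists x => x0 n f e cf /(re_gt0 S)[e0 <-]; set d := re S e in e0 *.
have [D D0 fD] := scalars_bound S n cf.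
have D1 : 0 < D + 1 by rewrite ltr_wpDl.
(* Three errors share [d]: the functionals on [v], on the error of [orbit_sequence] and on the
   distance from the target to [x0]. *)
have e4 : 0 < d / 4 by rewrite divr_gt0.
have [i hi] := tD x0 (d / 4 / (D + 1)) (divr_gt0 e4 D1).
have [k0 hk0] := half_pow_small D e4.
(* The bound of [near_orthogonal_bessel] with constant [D * C], once for each of the [n]
   functionals. *)
pose A : R := n%:R * (2 * (D * C) ^+ 2).
have [k [m [k0k hm hA]]] := hphi i ((A + 1) / (d / 4) ^+ 2) k0.
set s := fun k => 1 + \sum_(l < k) (qH (j (t (phi l))) + 1) in qv hA.
have s1 l : 1 <= s l by rewrite lerDl; apply: sumr_ge0 => q _; rewrite addr_ge0// qH_ge0.
have s0 l : 0 < s l by apply: lt_le_trans (s1 l).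
have fj l z : (l < n)%N -> F z -> nK (f l z) <= D * C * nH (j z).
  by move=> ln Fz; apply: le_trans (fD l z ln) _; rewrite -mulrA ler_wpM2l// j_bound.
(* Otherwise each repetition adds at least [(d / 4) ^+ 2 / s] to the sum over the functionals; by
   the choice of [m] the total is at least [A + 1], above its bound [A]. *)
have [r rm hr] : exists2 r, (r < m)%N & forall l, (l < n)%N -> nK (f l (v (k + r)%N)) < d / 4.
  apply: contrapT => no.
  have big r : (r < m)%N -> (d / 4) ^+ 2 <= \sum_(l < n) nK (f l (v (k + r)%N)) ^+ 2.
    move=> rm; have [l [ln hl]] : exists l, (l < n)%N /\ d / 4 <= nK (f l (v (k + r)%N)).
      apply: contrapT => nl; apply: no; exists r => // l ln.
      by rewrite ltNge; apply/negP => le; apply: nl; exists l.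
    rewrite (bigD1 (Ordinal ln))//=; apply: ler_wpDr.
      by apply: sumr_ge0 => q _; rewrite sqr_ge0.
    by rewrite ler_pXn2r ?nnegrE ?nK_ge0// ltW.
  have : (A + 1) / (d / 4) ^+ 2 * (d / 4) ^+ 2 <= A.
    apply: (@le_trans _ _ (\sum_(q < m) (s (k + q)%N)^-1 * (d / 4) ^+ 2)).
      by rewrite -mulr_suml ler_wpM2r ?sqr_ge0.
    apply: (@le_trans _ _ (\sum_(q < m) \sum_(l < n) nK (f l (v (k + q)%N)) ^+ 2 / s (k + q)%N)).
      apply: ler_sum => q _; rewrite -mulr_suml mulrC ler_wpM2r ?invr_ge0 ?(ltW (s0 _))//.
      exact: big.
    rewrite exchange_big/= /A -[n in n%:R]card_ord mulr_natl -sumr_const; apply: ler_sum => l _.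
    have := near_orthogonal_bessel linF j_lin (g := f l) (k + m)%N (mulr_ge0 D0 C0) (fun z => fj l z (ltn_ord l)) Fv s1 qv near.
    apply: le_trans; rewrite big_split_ord/= lerDr.
    by apply: sumr_ge0 => q _; rewrite divr_ge0 ?sqr_ge0 ?(ltW (s0 _)).
  rewrite divfK ?expf_neq0 ?gt_eqF//; lra.
exists (Tn (N (k + r)%N) x); first by exists (N (k + r)%N).
move=> l ln; rewrite -linearB -(toK_nK S) toK_lt.
set z := v (k + r)%N in hr; set y := t i.
have Txk := Tx (k + r)%N; rewrite hm// -/z -/y in Txk.
have -> : Tn (N (k + r)%N) x - x0 = (Tn (N (k + r)%N) x - (z + y)) + (z + (y - x0)).
  by rewrite [z + (y - x0)]addrA addrA subrK.
rewrite !linearD.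
apply: le_lt_trans (nKD _ _ _) _.
have h1 : nK (f l (Tn (N (k + r)%N) x - (z + y))) < d / 4.
  apply: le_lt_trans (fD _ _ ln) _; apply: le_lt_trans (hk0 (k + r)%N _).
    by rewrite ler_wpM2l.
  by rewrite (leq_trans k0k)// leq_addr.
have h2 : nK (f l (y - x0)) < d / 4.
  apply: le_lt_trans (fD _ _ ln) _; rewrite ltr_pdivlMr// mulrC in hi.
  by apply: le_lt_trans hi; rewrite ler_wpM2r ?nX_ge0// lerDl.
have h3 := hr l ln.
have h4 := nKD S (f l z) (f l (y - x0)).
rewrite !linearD in h1 h2 h4 *.
lra.
Qed.
End Construction.

(** * Assembly over an abstract scalar field *)

Lemma Theorem_1_2_scalars (R : realType) (K : numFieldType) (S : scalars R K)
  (sqrtK : K -> K) :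
  (forall k, 0 <= k -> sqrtK k ^+ 2 = k) -> Theorem_1_2 (cj S) sqrtK.
Proof.
move=> sqrtP X T F ip0 X_sep X_inf T_cont linF F_dense TF ip0_inner B1 [H [j [V]]].
move=> [j_lin [j_norm [j_dense [_ [Vj [V_iso V_irr]]]]]] back.
have j_norm2 x : F x -> `|j x| ^+ 2 = ip0 x x.
  move=> Fx; rewrite j_norm// sqrtP//; have [->|x0] := eqVneq x 0; last exact/ltW/ip0_inner.2.2.
  have := ip0_inner.1 1 0 0 0 linF.1 linF.1 linF.1.
  by rewrite scaler0 addr0 mul1r -[LHS]addr0 => /addrI <-.
pose HH := completion_hilbert linF ip0_inner j_lin j_norm2 j_dense.
have nHE x : nH HH x = nX S x by exact: nH_completion.
have jF_dense h (e : R) : 0 < e -> exists2 x, F x & nH HH (j x - h) < e.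
  move=> e0; have [_ [x Fx <-] hx] := dense_nX S h j_dense e0.
  by exists x => //; rewrite nHE.
(* Continuity at 0 with tolerance 1 suffices for a linear bound, by homogeneity. *)
have [d /(re_gt0 S)[d0 <-] hd] := B1 0 linF.1 1 ltr01.
have j_bound x : F x -> nX S x <= (re S d)^-1 * nH HH (j x).
  apply: (@bound_of_scaling _ _ S X F (@nX _ _ S X) (fun x => nH HH (j x)) (re S d)) => //.
  - by move=> a y; exact: lin_subspaceZ.
  - by move=> a y _; exact: nXZ.
  - by move=> a y Fy; rewrite (lin_onZ linF j_lin a Fy) nHZ.
  - by move=> y; exact: nH_ge0.
  move=> y Fy; rewrite nHE -(toK_lt S) toK_nX j_norm// => h.
  by have := hd y Fy; rewrite !subr0 -(toK_lt S) toK_nX rmorph1 => /(_ h).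
have H_long := long_orthonorm X_inf linF F_dense j_lin jF_dense j_bound.
have V_ip : forall x y, ip HH (V x) (V y) = ip HH x y by exact: ip_isometry.
have TF' x : F x -> F (T x) by move=> Fx; apply: TF; exists x.
apply: (weak_hypercyclicity (HH := HH) X_sep T_cont linF F_dense TF' j_lin _ j_bound Vj V_ip _ back).
  by rewrite invr_ge0 ltW.
by move=> w hs e N e0; have := @weak_recurrence _ _ _ _ HH V V_ip V_irr H_long w hs e N e0.
Qed.

(** * The real and complex instances *)

Lemma real_scalars (R : realType) : exists S : scalars R R, cj S = id :> (R -> R).
Proof.
unshelve eexists (@Scalars R R idfun idfun idfun 0 _ _ _ _ _ _ _ _) => //=.
- by move=> k; rewrite mulr_natl mulr2n.
- by move=> k; rewrite real_normK ?num_real.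
- by move=> k; rewrite mul0r addr0 mulr_natl mulr2n.
Qed.

Section ComplexScalars.
Variable R : realType.

(** A separate name for [complex.Re], carrying the additive structure that the field [re] asks
    for. *)
Definition real_part (z : R[i]) : R := complex.Re z.

Lemma real_part_is_additive : {morph real_part : x y / x - y}.
Proof. by move=> [a b] [c d]. Qed.

HB.instance Definition _ := GRing.isZmodMorphism.Build R[i] R real_part real_part_is_additive.

Lemma complex_scalars : exists S : scalars R R[i], cj S = Num.conj :> (R[i] -> R[i]).
Proof.
have conjE (z : R[i]) : Num.conj z = conjc z by [].
unshelve eexists (@Scalars R R[i] (real_complex R) real_part Num.conj 'i%C _ _ _ _ _ _ _ _) => //=.
- by move=> x y; exact: lecR.
- by move=> [a b]; rewrite lecE/= => /andP[/eqP-> _].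
- exact: conjCK.
- move=> [a b]; rewrite conjE; simpc; congr (_ +i* _)%C; rewrite /real_part/=; ring.
- by move=> k; rewrite -normCK.
- by move=> [a b]; rewrite /real_part/= -sqrtr_sqr ler_wsqrtr// lerDl sqr_ge0.
- by move=> k k0; apply: geC0_conj.
- move=> [a b]; rewrite !conjE mulr_natl mulr2n; simpc; congr (_ +i* _)%C; ring.
Qed.
End ComplexScalars.

(* K = R (conjugation = id, sqrt = Num.sqrt) and K = C = R[i] (conjC, sqrtC) *)
Theorem theorem1p2 :
  forall R : realType,
    @Theorem_1_2 (R : numFieldType) id Num.sqrt /\
    @Theorem_1_2 (R[i] : numFieldType) Num.conj sqrtC.
Proof.
move=> R; split.
  have [S <-] := real_scalars R; apply: Theorem_1_2_scalars => k; exact: sqr_sqrtr.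
have [S <-] := complex_scalars R; apply: Theorem_1_2_scalars => k _; exact: sqrtCK.
Qed.
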